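(* Let $d\in\mathbb{N}$, $r\in(0,\infty)$, and let $\mathcal{H}$ be a weighted Hardy space in $d$ variables and radius $r$. Then $\rho_{\mathrm{RK}}$ defines a metric on $[\mathcal{H}]_r$.
   Context: For $d\in\mathbb{N}$ and $r\in(0,\infty]$ let $r\mathbb{B}_d=\{z\in\mathbb{C}^d:|z|<r\}$ and $\overline{r\mathbb{B}_d}=\{z\in\mathbb{C}^d:|z|\le r\}$; $\langle\cdot,\cdot\rangle_d$ is the standard inner product on $\mathbb{C}^d$. A Hilbert function space (RKHS) on a set $X$ is a Hilbert space $\mathcal H$ of complex functions on $X$ all of whose point evaluations are bounded; $k_x\in\mathcal H$ is the vector with $f(x)=\langle f,k_x\rangle$ for all $f\in\mathcal H$. Generating function: a power series $G(t)=\sum_{n\ge0}a_nt^n$ with $a_0=1$, $a_n>0$ for all $n$, and radius of convergence in $(0,\infty]$. Weighted Hardy space in $d$ variables: a Hilbert function space of holomorphic functions on a ball centred at $0$ in $\mathbb{C}^d$, in which the monomials $z^\alpha$ form a complete orthogonal set of nonzero vectors with $\|z^\alpha\|^2/\alpha!=\|z^\beta\|^2/\beta!$ whenever $|\alpha|=|\beta|$, and $\|\mathbf{1}\|=1$. Equivalently its reproducing kernel is $K(z,w)=G(\langle z,w\rangle_d)$ for a (unique) generating function $G=\sum a_nt^n$, and then $\|z^\alpha\|^{-2}=a_{|\alpha|}\frac{|\alpha|!}{\alpha!}$. Convention: every weighted Hardy space is regarded as a space of functions on its natural maximal domain $X$, and its radius is the number $r$ such that $r^2\in(0,\infty]$ is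 the radius of convergence of $G$: $X=\mathbb{C}^d$ if $r=\infty$; $X=r\mathbb{B}_d$ if $r<\infty$ and $G(r^2)=\infty$; $X=\overline{r\mathbb{B}_d}$ if $r<\infty$ and $G(r^2)<\infty$ (functions then extend continuously to the closed ball). An RKHS isomorphism from $\mathcal{H}_1$ (on $X_1$) to $\mathcal{H}_2$ (on $X_2$) is a bijective bounded linear map $T:\mathcal{H}_1\to\mathcal{H}_2$ with $T(k^1_x)=\overline{\lambda(x)}\,k^2_{\varphi(x)}$ for all $x\in X_1$, where $\lambda:X_1\to\mathbb{C}$ is nowhere vanishing, $\varphi:X_1\to X_2$ is a bijection, and $k^i_x$ is the reproducing kernel vector of $\mathcal{H}_i$ at $x$. $[\mathcal{H}]_r$ is the class of all weighted Hardy spaces in $d$ variables and radius $r$ that are isomorphic to $\mathcal{H}$ via an RKHS isomorphism. Two elements are the same if they are the same Hilbert space of functions (equivalently, have the same generating function). $\delta_{\mathrm{RK}}(\mathcal{H}_1,\mathcal{H}_2)=\inf\{\|T\|\,\|T^{-1}\|: T:\mathcal{H}_1\to\mathcal{H}_2\text{ an RKHS isomorphism}\}$ and $\rho_{\mathrm{RK}}(\mathcal{H}_1,\mathcal{H}_2)=\log\delta_{\mathrm{RK}}(\mathcal{H}_1,\mathcal{H}_2)$. *)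

(* Defs.v *)
From HB Require Import structures.
From mathcomp Require Import all_boot all_order all_algebra.
From mathcomp Require Import complex.
From mathcomp Require Import all_classical all_reals all_analysis.
Set Implicit Arguments.
Unset Strict Implicit.
Unset Printing Implicit Defensive.
Import Order.TTheory GRing.Theory Num.Theory.
Import numFieldNormedType.Exports.
Local Open Scope classical_set_scope.
Local Open Scope ring_scope.
Local Open Scope complex_scope.

(* [numFieldNormedType] endows the carrier of an abstract numFieldType with its
   topology and norm, but not the concrete type R[i]. *)
#[non_forgetful_inheritance]
HB.instance Definition _ (R : realType) := NormedModule.copy R[i] R[i]^o.

(* A Hilbert space of complex functions on [hfs_dom], a subset of [X].  An
   element f is seen as the function x |-> hfs_ev f x on [hfs_dom]; the values
   of [hfs_ev f] off [hfs_dom] carry no information.  The inner product is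
   linear in its first argument and conjugate-linear in the second. *)
Record hilbert_function_space (R : realType) (X : Type) := HilbertFunctionSpace {
  hfs_sort :> completeNormedModType R[i];
  hfs_dot : {dot hfs_sort for Num.conj};
  hfs_dom : set X;
  hfs_ev : hfs_sort -> X -> R[i];
  hfs_normE : forall f : hfs_sort, `|f| ^+ 2 = hfs_dot f f;
  hfs_ev_linear : forall (a : R[i]) (f g : hfs_sort) x, hfs_dom x ->
    hfs_ev (a *: f + g) x = a * hfs_ev f x + hfs_ev g x;
  hfs_ev_inj : forall f g : hfs_sort,
    (forall x, hfs_dom x -> hfs_ev f x = hfs_ev g x) -> f = g;
  hfs_ev_bounded : forall x, hfs_dom x -> exists M : R,
    forall f : hfs_sort, `|hfs_ev f x| <= M%:C * `|f|
}.

Section HilbertFunctionSpaces.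
Context {R : realType} {X : Type}.
Implicit Types H K : hilbert_function_space R X.

(* The vector k_x; it exists and is unique, by the Riesz representation
   theorem, for every x in the domain. *)
Definition kernel_vec H (x : X) : H :=
  xget 0 [set k : H | forall f : H, hfs_ev f x = hfs_dot H f k].

Definition same_hfs H K : Prop :=
  hfs_dom H = hfs_dom K /\
  exists J : H -> K, [/\ bijective J,
    forall f x, hfs_dom H x -> hfs_ev (J f) x = hfs_ev f x &
    forall f g, hfs_dot K (J f) (J g) = hfs_dot H f g].

Definition op_norm H K (T : H -> K) : \bar R :=
  ereal_sup [set (complex.Re `|T f|)%:E | f in [set f : H | `|f| <= 1]].

Definition rk_iso H K (T : {linear H -> K}) : Prop :=
  [/\ bijective T,
      exists M : R, forall f : H, `|T f| <= M%:C * `|f| &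
      exists (lambda : X -> R[i]) (phi : X -> X),
        [/\ forall x, hfs_dom H x -> lambda x != 0,
            set_bij (hfs_dom H) (hfs_dom K) phi &
            forall x, hfs_dom H x ->
              T (kernel_vec H x) = Num.conj (lambda x) *: kernel_vec K (phi x)]].

Definition delta_RK H K : \bar R :=
  ereal_inf [set c | exists (T : {linear H -> K}) (S : K -> H),
    [/\ rk_iso T, cancel T S, cancel S T & c = (op_norm T * op_norm S)%E]].

Definition rho_RK H K : \bar R := lne (delta_RK H K).

End HilbertFunctionSpaces.

Section WeightedHardySpaces.
Context {R : realType}.

Definition cdot d (z w : 'rV[R[i]]_d) : R[i] :=
  \sum_(i < d) z 0 i * Num.conj (w 0 i).

(* The Euclidean norm; the library norm on row vectors is the max norm. *)
Definition cnorm d (z : 'rV[R[i]]_d) : R := Num.sqrt (complex.Re (cdot z z)).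

Definition conv_radius (a : nat -> R) : \bar R :=
  ereal_sup [set x%:E | x in [set x : R | 0 <= x /\ cvgn (pseries a x)]].

Definition generating_function (a : nat -> R) : Prop :=
  [/\ a 0%N = 1, forall n, 0 < a n & (0 < conv_radius a)%E].

(* As a_n > 0, G(r^2) < oo means that the series converges at r^2. *)
Definition natural_domain d (r : R) (a : nat -> R) : set 'rV[R[i]]_d :=
  if `[< cvgn (pseries a (r ^+ 2)) >]
  then [set z | cnorm z <= r] else [set z | cnorm z < r].

Definition mdegree d (al : {ffun 'I_d -> nat}) : nat := (\sum_(i < d) al i)%N.

Definition mfact d (al : {ffun 'I_d -> nat}) : R := \prod_(i < d) (al i)`!%:R.

Definition monomial d (al : {ffun 'I_d -> nat}) (z : 'rV[R[i]]_d) : R[i] :=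
  \prod_(i < d) z 0 i ^+ al i.

Definition weighted_hardy d (r : R)
    (H : hilbert_function_space R 'rV[R[i]]_d) : Prop :=
  exists (a : nat -> R) (m : {ffun 'I_d -> nat} -> H),
  [/\ [/\ generating_function a,
          conv_radius a = (r ^+ 2)%:E,
          hfs_dom H = natural_domain r a &
          forall z w, hfs_dom H z -> hfs_dom H w ->
            series (fun n => (a n)%:C * cdot z w ^+ n) @ \oo
              --> hfs_ev (kernel_vec H w) z],
      (* if the sphere lies in the domain, continuity says that the values there
         are those of the continuous extension from the open ball *)
      forall f : H,
        (forall z, cnorm z < r -> differentiable (hfs_ev f) z) /\
        {within hfs_dom H, continuous (hfs_ev f)},
      (* m al is z^al *)
      forall al z, hfs_dom H z -> hfs_ev (m al) z = monomial al z,
      [/\ forall al, m al != 0,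
          forall al be, al != be -> hfs_dot H (m al) (m be) = 0 &
          forall f : H, (forall al, hfs_dot H f (m al) = 0) -> f = 0] &
      (* the last clause follows from the formula for the kernel *)
      [/\ `|m [ffun=> 0%N]| = 1,
          forall al be, mdegree al = mdegree be ->
            `|m al| ^+ 2 / (mfact al)%:C = `|m be| ^+ 2 / (mfact be)%:C &
          forall al, `|m al| ^- 2 =
            (a (mdegree al) * (mdegree al)`!%:R / mfact al)%:C]].

Definition iso_class d (r : R) (H K : hilbert_function_space R 'rV[R[i]]_d) :
    Prop :=
  weighted_hardy r K /\ exists T : {linear H -> K}, rk_iso T.

End WeightedHardySpaces.

(* [rho] is a (finite-valued) metric on the class [A], where elements related
   by [same] are identified. *)
Record metric_on (R : realType) (E : Type) (A : E -> Prop)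
    (same : E -> E -> Prop) (rho : E -> E -> \bar R) : Prop := MetricOn {
  metric_on_fin : forall x y, A x -> A y -> rho x y \is a fin_num;
  metric_on_ge0 : forall x y, A x -> A y -> (0 <= rho x y)%E;
  metric_on_eq0 : forall x y, A x -> A y -> rho x y = 0%E <-> same x y;
  metric_on_sym : forall x y, A x -> A y -> rho x y = rho y x;
  metric_on_triangle : forall x y z, A x -> A y -> A z ->
    (rho x z <= rho x y + rho y z)%E
}.

(* Main.v *)
Require Import Defs.
From HB Require Import structures.
From mathcomp Require Import all_boot all_order all_algebra.
From mathcomp Require Import complex ring lra.
From mathcomp Require Import all_classical all_reals all_analysis.

(** Finiteness, symmetry and the triangle inequality hold for every class of
    nonzero, pairwise isomorphic spaces, once the inverse of an isomorphism is
    known to be bounded (bounded_inverse, rho_metric). The substance is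
    definiteness: if there are isomorphisms T : H -> K with condition numbers
    |T| |T^-1| arbitrarily close to 1, then H and K have the same generating
    function.

    Let phi be the bijection of the domains with T k_x proportional to k_(phi x),
    and suppose that phi 0 = 0. The angle between k_x and k_0 is a function of the
    norm |k_x|, and T distorts it by no more than the condition number allows
    (angle_distortion). If moreover |phi x| = |x|, then this compares the norms of
    k_x in H and in K, for the same x. They are equal in the limit, and so are the
    coefficients of the two generating functions (coefficients_le). A space with
    a given kernel is unique (kernel_eq_same).

    The equality |phi x| = |x| is the Schwarz lemma for phi and its inverse
    (schwarz). By the distortion of angles, |phi (s x)| = O(s). Let F in K vanish
    to order n at 0. Then <T k_(s x), F> = O(s^n), so that only the part of order
    at least n of k_x contributes to <T k_x, F> (dilation_error); the norm of that
    part decays like (|x|/rho)^n whenever |x| < rho < r. If F is a function that is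
    largest at phi x among the points of norm at most |phi x| (peak_exists), then
    |phi x| > |x| would bound the coefficients of K by those of a power series
    with a radius of convergence beyond r^2.

    The case phi 0 <> 0 is reduced to this one (fix_origin). Put p = phi 0,
    q = psi 0 with psi the inverse of phi. A maximum principle for psi on the disc
    through p shows that |psi (c p)| = |q| for some c of modulus 1
    (orbit_reaches). With u a unitary map from psi (c p) to q, the composition of
    phi, the rotation by c, psi, u and phi fixes 0. It belongs to an isomorphism
    with condition number at most the cube of that of T, which still tends to 1.

    All analysis of functions on the ball is done with finite combinations of
    kernel vectors at multiples z x of one point x: such a combination multiplies
    the homogeneous parts of k_x by explicit scalars (comb, coef). Dilations by
    powers of t kill the parts of low degree; averages over regular polygons keep
    only the parts of degree divisible by 2^j, and replace mean values over
    circles. *)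

Set Implicit Arguments.
Unset Strict Implicit.
Unset Printing Implicit Defensive.
Import Order.TTheory GRing.Theory Num.Theory.
Import numFieldNormedType.Exports.
Local Open Scope classical_set_scope.
Local Open Scope ring_scope.
Local Open Scope complex_scope.

(** * Complex numbers and Hilbert spaces with a real-valued norm *)

Section ComplexModulus.
Variable R : realType.
Implicit Types z : R[i].

(** The norm of a normed space over R[i] has its values in R[i]; this is the
    same norm as a real number, so that the tools for real inequalities apply. *)
Definition rn (V : normedZmodType R[i]) (v : V) : R := complex.Re `|v|.

Section NormedZmod.
Variable V : normedZmodType R[i].
Implicit Types v w : V.

Lemma rnE v : `|v| = (rn v)%:C.
Proof. by rewrite /rn RRe_real// normr_real. Qed.

Lemma rn_ge0 v : 0 <= rn v.
Proof. by rewrite -lecR -rnE normr_ge0. Qed.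

Lemma rn_eq0 v : (rn v == 0) = (v == 0).
Proof. by rewrite -(inj_eq (@complexI R)) -rnE normr_eq0. Qed.

Lemma rn0 : rn (0 : V) = 0.
Proof. by apply/eqP; rewrite rn_eq0. Qed.

Lemma rnD v w : rn (v + w) <= rn v + rn w.
Proof. by rewrite -lecR rmorphD /= -!rnE ler_normD. Qed.

Lemma rnN v : rn (- v) = rn v.
Proof. by rewrite /rn normrN. Qed.

Lemma rnBC v w : rn (v - w) = rn (w - v).
Proof. by rewrite /rn distrC. Qed.

Lemma rnB v w : rn (v - w) <= rn v + rn w.
Proof. by rewrite -[rn w]rnN rnD. Qed.

Lemma rn_triangle u v w : rn (v - w) <= rn (v - u) + rn (u - w).
Proof. by rewrite -(subrKA u) rnD. Qed.

Lemma ler_rn_dist v w : `|rn v - rn w| <= rn (v - w).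
Proof.
have h1 := rnD (v - w) w; have h2 := rnD (w - v) v.
rewrite subrK in h1; rewrite subrK rnBC in h2.
by rewrite ler_norml; apply/andP; split; lra.
Qed.

End NormedZmod.

Lemma rnZ (V : normedModType R[i]) (a : R[i]) (v : V) : rn (a *: v) = rn a * rn v.
Proof. by apply: (@complexI R); rewrite rmorphM /= -!rnE normrZ. Qed.

Lemma rnM z w : rn (z * w) = rn z * rn w.
Proof. by apply: (@complexI R); rewrite rmorphM /= -!rnE normrM. Qed.

Lemma rnX z n : rn (z ^+ n) = rn z ^+ n.
Proof. by apply: (@complexI R); rewrite rmorphXn /= -!rnE normrX. Qed.

Lemma rn_conj z : rn (Num.conj z) = rn z.
Proof. by rewrite /rn norm_conjC. Qed.

Lemma rn_real (x : R) : rn x%:C = `|x|.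
Proof. by rewrite /rn normc_def /= expr0n addr0 sqrtr_sqr. Qed.

Lemma rn1 : rn (1 : R[i]) = 1.
Proof. by rewrite (rn_real 1) normr1. Qed.

Lemma Re_add z w : complex.Re (z + w) = complex.Re z + complex.Re w.
Proof. by case: z => a b; case: w. Qed.

Lemma Re_opp z : complex.Re (- z) = - complex.Re z.
Proof. by case: z. Qed.

Lemma Re_sub z w : complex.Re (z - w) = complex.Re z - complex.Re w.
Proof. by rewrite Re_add Re_opp. Qed.

Lemma Re_scale (x : R) z : complex.Re (x%:C * z) = x * complex.Re z.
Proof. by case: z => a b /=; rewrite mul0r subr0. Qed.

Lemma Re_conj z : complex.Re (Num.conj z) = complex.Re z.
Proof. by apply: (@complexI R); rewrite !complexRe Re_conj. Qed.

Lemma ler_Re_rn z : `|complex.Re z| <= rn z.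
Proof. by rewrite -lecR -rnE normc_ge_Re. Qed.

Lemma Re_le_rn z : complex.Re z <= rn z.
Proof. exact: le_trans (ler_norm _) (ler_Re_rn z). Qed.

Lemma mulr_conj z : z * Num.conj z = (rn z ^+ 2)%:C.
Proof. by rewrite -normCK rnE rmorphXn. Qed.

Lemma conj_real (x : R) : Num.conj x%:C = x%:C.
Proof. by apply/CrealP; rewrite complex_real. Qed.

End ComplexModulus.

Section HilbertSpace.
Variables (R : realType) (X : Type) (H : hilbert_function_space R X).
Implicit Types (f g v w : H) (a : R[i]).
Local Notation "<[ f , g ]>" := (hfs_dot H f g).

Lemma dotC f g : <[g, f]> = Num.conj <[f, g]>.
Proof. by rewrite (hermC (hfs_dot H)) expr0 mul1r. Qed.

Lemma dotDl f g v : <[f + g, v]> = <[f, v]> + <[g, v]>.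
Proof. exact: linearDl. Qed.
Lemma dotBl f g v : <[f - g, v]> = <[f, v]> - <[g, v]>.
Proof. exact: linearBl. Qed.
Lemma dotZl a f v : <[a *: f, v]> = a * <[f, v]>.
Proof. exact: linearZl_LR. Qed.
Lemma dot0l v : <[0, v]> = 0.
Proof. exact: linear0l. Qed.
Lemma dotDr f g v : <[v, f + g]> = <[v, f]> + <[v, g]>.
Proof. by rewrite dotC dotDl rmorphD /= -!dotC. Qed.
Lemma dotBr f g v : <[v, f - g]> = <[v, f]> - <[v, g]>.
Proof. by rewrite dotC dotBl rmorphB /= -!dotC. Qed.
Lemma dotZr a f v : <[v, a *: f]> = Num.conj a * <[v, f]>.
Proof. by rewrite dotC dotZl rmorphM /= -!dotC. Qed.
Lemma dot0r v : <[v, 0]> = 0.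
Proof. by rewrite dotC dot0l rmorph0. Qed.

Lemma dot_self f : <[f, f]> = (rn f ^+ 2)%:C.
Proof. by rewrite -hfs_normE rnE rmorphXn. Qed.

Lemma rn_sqr f : rn f ^+ 2 = complex.Re <[f, f]>.
Proof. by rewrite dot_self. Qed.

Lemma Re_dotC f g : complex.Re <[g, f]> = complex.Re <[f, g]>.
Proof. by rewrite dotC Re_conj. Qed.

Lemma rnD_sqr f g :
  rn (f + g) ^+ 2 = rn f ^+ 2 + rn g ^+ 2 + 2 * complex.Re <[f, g]>.
Proof.
by rewrite !rn_sqr dotDl !dotDr !Re_add (Re_dotC f g); ring.
Qed.

Lemma rnB_sqr f g :
  rn (f - g) ^+ 2 = rn f ^+ 2 + rn g ^+ 2 - 2 * complex.Re <[f, g]>.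
Proof.
by rewrite !rn_sqr dotBl !dotBr !Re_sub (Re_dotC f g); ring.
Qed.

(** The norm of |g|^2 f - <f, g> g is nonnegative. *)
Lemma dot_CS f g : rn <[f, g]> <= rn f * rn g.
Proof.
rewrite -(@ler_pXn2r _ 2%N) ?nnegrE ?mulr_ge0 ?rn_ge0// exprMn.
have [->|g0] := eqVneq g 0; first by rewrite dot0r !rn0 expr0n mulr0.
have G0 : 0 < rn g ^+ 2 by rewrite exprn_gt0// lt_def rn_eq0 g0 rn_ge0.
have := sqr_ge0 (rn ((rn g ^+ 2)%:C *: f - <[f, g]> *: g)).
rewrite rnB_sqr !rnZ dotZl dotZr Re_scale [Num.conj _ * _]mulrC mulr_conj /=.
rewrite rn_real (ger0_norm (ltW G0)) => h.
rewrite -subr_ge0 -(pmulr_rge0 _ G0).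
by apply: le_trans h _; rewrite le_eqVlt; apply/orP; left; apply/eqP; ring.
Qed.

Lemma dot_eqP f g : (forall v, <[v, f]> = <[v, g]>) -> f = g.
Proof.
move=> e; apply/eqP; rewrite -subr_eq0 -rn_eq0 -sqrf_eq0 rn_sqr dotBr e subrr.
by [].
Qed.

Lemma hilbert_complete (u : nat -> H) :
  (forall e : R, 0 < e ->
    exists N, forall m n, (N <= m)%N -> (N <= n)%N -> rn (u m - u n) < e) ->
  exists v, forall e : R, 0 < e ->
    exists N, forall n, (N <= n)%N -> rn (u n - v) < e.
Proof.
move=> cau; have cu : cvgn u.
  apply/cauchy_cvgP; apply/cauchy_ballP => e e0.
  have e0' : 0 < complex.Re e by move: e0; rewrite ltcE => /andP[].
  have [N hN] := cau _ e0'.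
  pose S := u @` [set n | (N <= n)%N].
  exists (S, S); first by split; exists N => // n Nn; exists n.
  move=> [_ _] /= [[m Nm <-] [n Nn <-]]; rewrite -ball_normE /= rnE.
  by rewrite -[e](@RRe_real R) ?gtr0_real// ltcR hN.
exists (lim (u @ \oo)) => e e0.
have /cvgrPdist_lt /(_ e%:C) := cu; rewrite ltcR => /(_ e0)[N _ hN].
by exists N => n /hN /=; rewrite rnE ltcR rnBC.
Qed.

End HilbertSpace.

(** * The Riesz representation theorem *)

Lemma invS_lt (R : realType) (e : R) : 0 < e ->
  exists N, forall n, (N <= n)%N -> n.+1%:R^-1 < e.
Proof.
move=> e0; have [N _ hN] := @near_infty_natSinv_lt R (PosNum e0).
by exists N => n /hN.
Qed.

Section Riesz.
Variables (R : realType) (X : Type) (H : hilbert_function_space R X).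
Implicit Types (f g v w : H) (a : R[i]).
Local Notation "<[ f , g ]>" := (hfs_dot H f g).

(** The vector v minimizes J(w) = |w|^2 - 2 Re (l w): a minimizing sequence in W
    is a Cauchy sequence by the parallelogram law, and the first variation of J
    vanishes at its limit. For W the whole space this is the Riesz representation
    theorem; for l = <_, f> it says that f is approximated by vectors of W if no
    other vector has the same inner products with W. *)
Lemma riesz_subspace (W : H -> Prop) (l : H -> R[i]) (M : R) :
  W 0 -> (forall a f g, W f -> W g -> W (a *: f + g)) ->
  (forall a f g, W f -> W g -> l (a *: f + g) = a * l f + l g) ->
  (forall f, W f -> rn (l f) <= M * rn f) ->
  exists v, (forall w, W w -> l w = <[w, v]>) /\
    (forall e : R, 0 < e -> exists2 w, W w & rn (w - v) < e).
Proof.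
move=> W0 WD lD lM.
have l0 : l 0 = 0.
  by have := lD 1 0 0 W0 W0; rewrite scaler0 addr0 mul1r => /eqP;
     rewrite -subr_eq0 opprD addrA subrr add0r oppr_eq0 => /eqP.
have WZ a f : W f -> W (a *: f) by move=> Wf; rewrite -[_ *: _]addr0; exact: WD.
have WA f g : W f -> W g -> W (f + g).
  by move=> Wf Wg; rewrite -[f]scale1r; exact: WD.
have lZ a f : W f -> l (a *: f) = a * l f.
  by move=> Wf; rewrite -[_ *: _]addr0 lD// l0 addr0.
have lA f g : W f -> W g -> l (f + g) = l f + l g.
  by move=> Wf Wg; have := lD 1 f g Wf Wg; rewrite scale1r mul1r.
pose J f := rn f ^+ 2 - 2 * complex.Re (l f).
pose S := [set J w | w in [set w | W w]].
have hS : has_inf S.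
  split; first by exists (J 0), 0.
  exists (- M ^+ 2) => _ [w Ww <-]; rewrite /J.
  have h1 := le_trans (Re_le_rn (l w)) (lM _ Ww).
  have := sqr_ge0 (rn w - M); rewrite sqrrB => h2.
  by nra.
pose m := inf S.
have mJ w : W w -> m <= J w.
  by move=> Ww; apply: ge_inf; [exact: hS.2 | exists w].
have /choice[u hu] : forall n, exists w, W w /\ J w < m + n.+1%:R^-1.
  move=> n; have n0 : 0 < n.+1%:R^-1 :> R by rewrite invr_gt0.
  have [_ [w Ww <-] hw] := inf_adherent n0 hS.
  by exists w.
have [v hv] : exists v, forall e : R, 0 < e ->
    exists N, forall n, (N <= n)%N -> rn (u n - v) < e.
  apply: hilbert_complete => e e0.
  have [N hN] := @invS_lt R (e ^+ 2 / 4) ltac:(by rewrite divr_gt0// exprn_gt0).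
  exists N => p q Np Nq.
  have [Wp Jp] := hu p; have [Wq Jq] := hu q.
  have hp := hN _ Np; have hq := hN _ Nq.
  (* compare J at u p, u q and their midpoint *)
  have := mJ _ (WZ (2^-1)%:C _ (WA _ _ Wp Wq)).
  rewrite /J rnZ lZ; last exact: WA.
  rewrite Re_scale lA// Re_add rn_real ger0_norm ?invr_ge0// exprMn rnD_sqr.
  move=> hm.
  rewrite -(@ltr_pXn2r _ 2%N) ?nnegrE ?rn_ge0 ?ltW// rnB_sqr.
  move: Jp Jq; rewrite /J.
  move: (p.+1%:R^-1) (q.+1%:R^-1) hp hq hm => P Q.
  by rewrite exprVn; lra.
exists v; split; last first.
  move=> e e0; have [N hN] := hv _ e0.
  by exists (u N); [exact: (hu N).1 | exact: hN].
move=> w Ww.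
apply/eqP; rewrite -subr_eq0 -rn_eq0; apply/negPn/negP => n0.
have d0 : 0 < rn (l w - <[w, v]>) by rewrite lt_def n0 rn_ge0.
(* the step is small enough for the quadratic term to cost at most half of the gain *)
pose s := (1 + rn w ^+ 2)^-1.
have ge0w : 0 <= rn w ^+ 2 by rewrite exprn_ge0// rn_ge0.
have s0 : 0 < s by rewrite invr_gt0 ltr_pwDl.
have sw : s * rn w ^+ 2 <= 1.
  by rewrite mulrC ler_pdivrMr ?mul1r ?lerDr// ltr_pwDl.
have key n : s * rn (l w - <[w, u n]>) ^+ 2 <= n.+1%:R^-1.
  have [Wn Jn] := hu n.
  (* vary u n in the direction of w, with the phase that decreases J most *)
  pose de := l w - <[w, u n]>.
  have := mJ _ (WD (s%:C * Num.conj de) _ _ Ww Wn).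
  rewrite /J lD// rnD_sqr rnZ rnM rn_conj rn_real (ger0_norm (ltW s0)).
  rewrite dotZl -!mulrA Re_add !Re_scale.
  have hde : complex.Re (Num.conj de * <[w, u n]>) -
      complex.Re (Num.conj de * l w) = - rn de ^+ 2.
    by rewrite -Re_sub -mulrBr -opprB mulrN Re_opp mulrC mulr_conj.
  have h4 : s ^+ 2 * rn de ^+ 2 * rn w ^+ 2 <= s * rn de ^+ 2.
    rewrite (_ : s ^+ 2 * _ * _ = s * rn de ^+ 2 * (s * rn w ^+ 2)); last by ring.
    by rewrite ler_piMr// mulr_ge0 ?sqr_ge0// ltW.
  move: Jn h4 hde; rewrite /J -/de !exprMn.
  move: (n.+1%:R^-1) (complex.Re (Num.conj de * _)) (complex.Re (Num.conj de * _)).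
  by move=> P A B; nra.
pose E0 := rn (l w - <[w, v]>).
have E0le n : E0 <= rn (l w - <[w, u n]>) + rn w * rn (u n - v).
  apply: le_trans (rn_triangle <[w, u n]> _ _) _.
  by rewrite lerD2l -dotBr dot_CS.
have [N1 h1] := hv (E0 / 2 / (1 + rn w)) ltac:(by rewrite !divr_gt0// ltr_pwDl// rn_ge0).
have [N2 h2] := @invS_lt R (s * (E0 / 2) ^+ 2) ltac:(by rewrite mulr_gt0// exprn_gt0// divr_gt0).
pose n := maxn N1 N2.
have := h1 n (leq_maxl _ _); rewrite ltr_pdivlMr ?ltr_pwDl ?rn_ge0// => h3.
have := le_lt_trans (key n) (h2 n (leq_maxr _ _)); rewrite ltr_pM2l//.
rewrite ltr_pXn2r ?nnegrE ?rn_ge0 ?divr_ge0 ?rn_ge0// => h4.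
have h5 : rn w * rn (u n - v) <= rn (u n - v) * (1 + rn w).
  by rewrite mulrDr mulr1 [rn w * _]mulrC lerDr rn_ge0.
have := E0le n; lra.
Qed.

Lemma riesz (l : H -> R[i]) (M : R) :
  (forall a f g, l (a *: f + g) = a * l f + l g) ->
  (forall f, rn (l f) <= M * rn f) ->
  exists v, forall w, l w = <[w, v]>.
Proof.
move=> lD lM.
have [//|//|a f g _ _|f _|v [hv _]] := @riesz_subspace (fun _ => True) l M.
- exact: lD.
- exact: lM.
by exists v => w; apply: hv.
Qed.

(** The default value in the definition of kernel_vec is not taken, by the
    boundedness of the evaluations. *)
Lemma kernel_vecP x f : hfs_dom H x -> hfs_ev f x = <[f, kernel_vec H x]>.
Proof.
move=> Hx; have [M hM] := hfs_ev_bounded Hx.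
have [v hv] : exists v : H, forall f : H, hfs_ev f x = <[f, v]>.
  apply: (@riesz _ M) => [a g h|g]; first exact: hfs_ev_linear.
  by rewrite -lecR rmorphM /= -!rnE.
have : [set k : H | forall f : H, hfs_ev f x = hfs_dot H f k] (kernel_vec H x).
  exact: (@xgetI _ _ _ v hv).
exact.
Qed.

Lemma dot_kernel_eq f g :
  (forall x, hfs_dom H x -> <[f, kernel_vec H x]> = <[g, kernel_vec H x]>) -> f = g.
Proof.
by move=> e; apply: hfs_ev_inj => x Hx; rewrite !kernel_vecP// e.
Qed.

Definition kcomb (s : seq (R[i] * X)) : H :=
  \sum_(c <- s) c.1 *: kernel_vec H c.2.

Definition pts_in (s : seq (R[i] * X)) := forall c, List.In c s -> hfs_dom H c.2.

(** A vector is determined by its inner products with the kernel vectors, which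
    are its values. *)
Lemma kcomb_dense f (e : R) : 0 < e ->
  exists2 s, pts_in s & rn (f - kcomb s) < e.
Proof.
pose W g := exists2 s, pts_in s & g = kcomb s.
have WP a g h : W g -> W h -> W (a *: g + h).
  move=> [s sP ->] [t tP ->].
  exists ([seq (a * c.1, c.2) | c <- s] ++ t).
    move=> c /(List.in_app_or _ _ _)[|/tP//].
    by move=> /(List.in_map_iff _ _ _)[b [<- /sP]].
  rewrite /kcomb big_cat big_map scaler_sumr; congr (_ + _).
  by apply: eq_bigr => i _; rewrite scalerA.
have W0 : W 0 by exists [::] => //; rewrite /kcomb big_nil.
have [] := @riesz_subspace W (fun w => <[w, f]>) (rn f) W0 WP.
- by move=> a g h _ _; rewrite dotDl dotZl.
- by move=> g _; rewrite mulrC dot_CS.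
move=> v [hv dv] e0; have -> : f = v.
  apply: dot_kernel_eq => x Hx; rewrite dotC [RHS]dotC; congr Num.conj.
  apply: hv; exists [:: (1, x)]; first by move=> c [<-//|[]].
  by rewrite /kcomb big_seq1 scale1r.
by have [_ [s sP ->]] := dv _ e0; exists s => //; rewrite rnBC.
Qed.

End Riesz.

(** * Uniform boundedness and bounded inverses *)

Section UniformBoundedness.
Variables (R : realType) (X : Type) (H : hilbert_function_space R X).
Implicit Types (f g h v : H).
Local Notation "<[ f , g ]>" := (hfs_dot H f g).

(** One of the two steps of length t along plus or minus h produces a large
    inner product, because <x + y, h> - <x - y, h> = 2 <y, h>. *)
Lemma move_away h f (t : R) : 0 <= t -> exists g,
  rn (g - f) <= t /\ t * rn h <= rn <[g, h]>.
Proof.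
move=> t0; have [->|h0] := eqVneq h 0.
  by exists f; rewrite subrr !rn0 mulr0 rn_ge0.
have hp : 0 < rn h by rewrite lt_def rn_eq0 h0 rn_ge0.
pose y := (t / rn h)%:C *: h.
have tq : 0 <= t / rn h by rewrite divr_ge0// ltW.
have ny : rn y = t by rewrite rnZ rn_real ger0_norm// divfK ?gt_eqF.
have yh : rn <[y, h]> = t * rn h.
  rewrite dotZl dot_self rnM !rn_real !ger0_norm ?sqr_ge0//.
  by field; rewrite gt_eqF.
have [|lt1] := leP (t * rn h) (rn <[f + y, h]>).
  by move=> le1; exists (f + y); rewrite addrC addKr ny.
exists (f - y); rewrite addrC addKr rnN ny; split=> //.
have := rnB <[f + y, h]> <[f - y, h]>.
have -> : <[f + y, h]> - <[f - y, h]> = 2%:R%:C * <[y, h]>.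
  by rewrite dotDl dotBl rmorph_nat; ring.
by rewrite rnM rn_real normr_nat yh; lra.
Qed.

(** A gliding hump: if h n in D has norm at least n 3^n,
    then successive steps of length 3^-n, each chosen by move_away so that
    <x, h n> becomes large, lead to a limit at which the later steps, of total
    length at most half of 3^-n, cannot have undone this. *)
Theorem uniform_boundedness (D : H -> Prop) :
  (forall f, exists C, forall h, D h -> rn <[f, h]> <= C) ->
  exists M, forall h, D h -> rn h <= M.
Proof.
move=> bD; apply: contrapT => nM.
pose t n : R := 3^-1 ^+ n.
have t0 n : 0 < t n by rewrite exprn_gt0// invr_gt0.
have tS n : t n.+1 = 3^-1 * t n by rewrite /t exprS.
have /choice[h hP] : forall n, exists h, D h /\ n%:R / t n < rn h.
  move=> n; apply: contrapT => nh; apply: nM; exists (n%:R / t n) => h Dh.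
  by rewrite leNgt; apply/negP => lt; apply: nh; exists h.
have /choice[F FP] : forall p : nat * H, exists g,
    rn (g - p.2) <= t p.1 /\ t p.1 * rn (h p.1) <= rn <[g, h p.1]>.
  by move=> [n f]; apply: move_away; rewrite ltW.
pose x := fix x n := if n is m.+1 then F (m, x m) else 0.
have xS n : rn (x n.+1 - x n) <= t n by case: (FP (n, x n)).
have xh n : t n * rn (h n) <= rn <[x n.+1, h n]> by case: (FP (n, x n)).
have xD n k : rn (x (n + k)%N - x n) <= 3 / 2 * t n - 3 / 2 * t (n + k)%N.
  elim: k => [|k IH]; first by rewrite addn0 !subrr rn0.
  rewrite addnS; apply: le_trans (rn_triangle (x (n + k)%N) _ _) _.
  by have := xS (n + k)%N; rewrite tS; lra.
have xD' m n : (n <= m)%N -> rn (x m - x n) <= 3 / 2 * t n.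
  move=> nm; have := xD n (m - n)%N; rewrite subnKC// => /le_trans; apply.
  by have := t0 m; lra.
have tlt (e : R) : 0 < e -> exists N, t N < e.
  move=> e0; have [N hN] := invS_lt e0; exists N.
  apply: le_lt_trans (hN N (leqnn _)).
  rewrite /t exprVn lef_pV2 ?posrE ?exprn_gt0 ?ltr0n//.
  by rewrite -natrX ler_nat; apply: ltn_expl.
have [v hv] : exists v, forall e : R, 0 < e ->
    exists N, forall n, (N <= n)%N -> rn (x n - v) < e.
  apply: hilbert_complete => e e0.
  have [N hN] := tlt (e / 3) ltac:(by rewrite divr_gt0).
  exists N => m n /xD' hm /xD' hn.
  apply: le_lt_trans (rn_triangle (x N) _ _) _; rewrite [rn (x N - _)]rnBC.
  by lra.
have vx n : rn (v - x n.+1) <= 2^-1 * t n.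
  apply/ler_addgt0Pr => e e0; have [N hN] := hv e e0.
  apply: le_trans (rn_triangle (x (maxn N n.+1)) _ _) _.
  have := xD' _ _ (leq_maxr N n.+1); rewrite tS rnBC.
  have := hN _ (leq_maxl N n.+1); rewrite rnBC; lra.
have vh n : n%:R / 2 <= rn <[v, h n]>.
  have [_ hn] := hP n.
  have h1 : rn <[x n.+1, h n]> <= rn <[v, h n]> + 2^-1 * t n * rn (h n).
    rewrite -{1}(subrK v (x n.+1)) dotDl addrC.
    apply: le_trans (rnD _ _) _; rewrite lerD2l.
    apply: le_trans (dot_CS _ _) _; rewrite rnBC ler_wpM2r ?rn_ge0//.
  have := xh n; move: hn; rewrite ltr_pdivrMr// [_ * t n]mulrC; lra.
have [C hC] := bD v.
have := hC (h (Num.trunc (2 * C)).+1) (hP _).1.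
have := vh (Num.trunc (2 * C)).+1.
have := truncnS_gt (2 * C).
lra.
Qed.

End UniformBoundedness.

Section BoundedInverse.
Variables (R : realType) (X : Type) (H K : hilbert_function_space R X).

(** The adjoint of T is bounded below: by surjectivity of T, the vectors h with
    |T^* h| <= 1 are pointwise bounded, since <T f, h> = <f, T^* h>.
    For f = S g close to T^* h, the square |f|^2 is then close to
    <f, T^* h> = <g, h>, hence at most about M |g| |f|. *)
Theorem bounded_inverse (T : H -> K) (S : K -> H) (A : R) :
  (forall a f g, T (a *: f + g) = a *: T f + T g) ->
  (forall f, rn (T f) <= A * rn f) -> cancel S T -> cancel T S ->
  exists B, forall g, rn (S g) <= B * rn g.
Proof.
move=> lT bT SK TK.
have A0 : 0 <= `|A| by [].
have bT' f : rn (T f) <= `|A| * rn f.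
  by apply: le_trans (bT f) _; rewrite ler_wpM2r ?rn_ge0// ler_norm.
have /choice[T' hT'] : forall h : K, exists v : H,
    forall f, hfs_dot K (T f) h = hfs_dot H f v.
  move=> h; apply: (@riesz _ _ _ _ (`|A| * rn h)) => [a f g|f].
    by rewrite lT dotDl dotZl.
  by apply: le_trans (dot_CS _ _) _; rewrite mulrAC ler_wpM2r ?rn_ge0.
have T'D a g h : T' (a *: g + h) = a *: T' g + T' h.
  by apply: dot_eqP => f; rewrite -hT' !(dotDr, dotZr) -!hT'.
have T'0 : T' 0 = 0 by apply: dot_eqP => f; rewrite -hT' !dot0r.
have T'Z a g : T' (a *: g) = a *: T' g.
  by rewrite -[a *: g]addr0 T'D T'0 addr0.
have [|M hM] := @uniform_boundedness R X K (fun h => rn (T' h) <= 1).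
  move=> g; exists (rn (S g)) => h h1; rewrite -{1}(SK g) hT'.
  by apply: le_trans (dot_CS _ _) _; rewrite ler_piMr ?rn_ge0.
have M0 : 0 <= M by have := hM 0; rewrite T'0 !rn0; apply.
have below h : rn h <= M * rn (T' h).
  have [n0|n0] := eqVneq (rn (T' h)) 0.
    have /eqP := n0; rewrite rn_eq0 => /eqP h0.
    have -> : h = 0.
      by apply: dot_eqP => g; rewrite -(SK g) hT' h0 !dot0r.
    by rewrite rn0 mulr_ge0 ?rn_ge0.
  have np : 0 < rn (T' h) by rewrite lt_def n0 rn_ge0.
  have := hM ((rn (T' h))^-1%:C *: h).
  rewrite T'Z !rnZ rn_real ger0_norm ?invr_ge0 ?rn_ge0//.
  by rewrite mulVf// ler_pdivrMl// [_ * M]mulrC; apply.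
exists M => g; set f := S g.
have [f0|f0] := eqVneq f 0.
  by rewrite f0 rn0 mulr_ge0 ?rn_ge0.
have fp : 0 < rn f by rewrite lt_def rn_eq0 f0 rn_ge0.
(* the range of the adjoint is dense, as T is injective *)
have dense e : 0 < e -> exists h, rn (f - T' h) < e.
  pose W v := exists h, v = T' h.
  have [||a|a|v [hv dv]] := @riesz_subspace R X H W (fun w => hfs_dot H w f) (rn f).
  - by exists 0.
  - by move=> a _ _ [h1 ->] [h2 ->]; exists (a *: h1 + h2); rewrite T'D.
  - by move=> u v _ _; rewrite dotDl dotZl.
  - by move=> _; rewrite mulrC dot_CS.
  have -> : f = v.
    apply: (can_inj TK); apply: dot_eqP => h.
    rewrite dotC hT' -dotC hv; last by exists h.
    by rewrite dotC -hT' -dotC.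
  by move=> e0; have [_ [h ->] hd] := dv _ e0; exists h; rewrite rnBC.
suff : rn f ^+ 2 <= M * rn g * rn f by rewrite expr2 ler_pM2r.
apply/ler_addgt0Pr => e e0.
have Mg : 0 <= M * rn g by rewrite mulr_ge0// rn_ge0.
have D0 : 0 < 1 + rn f + M * rn g by rewrite !ltr_pwDl// rn_ge0.
have [h] := dense _ (divr_gt0 e0 D0); rewrite ltr_pdivlMr//.
set z := rn (f - T' h) => hz.
have z0 : 0 <= z by rewrite rn_ge0.
have Th : rn (T' h) <= rn f + z.
  by have := rnB f (f - T' h); rewrite subKr.
rewrite rn_sqr -{2}[f](subrK (T' h)) dotDr Re_add -hT' SK.
have h1 := le_trans (Re_le_rn _) (dot_CS f (f - T' h)).
have h2 := le_trans (Re_le_rn _) (dot_CS g h).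
have h3 : rn g * rn h <= M * rn g * (rn f + z).
  rewrite -mulrA mulrCA ler_wpM2l ?rn_ge0//.
  by apply: le_trans (below h) _; rewrite ler_wpM2l.
rewrite -/z in h1.
nra.
Qed.

End BoundedInverse.

(** * RKHS isomorphisms and the distance *)

Lemma scaleP (K : pzRingType) (V W : lmodType K) (U : V -> W) :
  (forall a f g, U (a *: f + g) = a *: U f + U g) ->
  forall a f, U (a *: f) = a *: U f.
Proof.
move=> lU a f; have U0 : U 0 = 0.
  by have := lU (-1) 0 0; rewrite scaler0 addr0 scaleN1r addNr.
by rewrite -[a *: f]addr0 lU U0 addr0.
Qed.

Section KernelIsomorphisms.
Variables (R : realType) (X : Type).
Implicit Types H K L : hilbert_function_space R X.

(** An RKHS isomorphism together with its inverse and bounds for the norms of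
    both; a form of isomorphism that is symmetric in the two spaces. *)
Record rk_pair H K (A B : R) (phi psi : X -> X) (T : H -> K) (S : K -> H)
    (lam mu : X -> R[i]) : Prop := RkPair {
  rp_linT : forall a f g, T (a *: f + g) = a *: T f + T g;
  rp_linS : forall a f g, S (a *: f + g) = a *: S f + S g;
  rp_TK : cancel T S;
  rp_SK : cancel S T;
  rp_A0 : 0 <= A;
  rp_B0 : 0 <= B;
  rp_bT : forall f, rn (T f) <= A * rn f;
  rp_bS : forall g, rn (S g) <= B * rn g;
  rp_phi : forall x, hfs_dom H x -> hfs_dom K (phi x);
  rp_psi : forall y, hfs_dom K y -> hfs_dom H (psi y);
  rp_phiK : forall x, hfs_dom H x -> psi (phi x) = x;
  rp_psiK : forall y, hfs_dom K y -> phi (psi y) = y;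
  rp_lam : forall x, hfs_dom H x -> lam x != 0;
  rp_mu : forall y, hfs_dom K y -> mu y != 0;
  rp_kT : forall x, hfs_dom H x ->
    T (kernel_vec H x) = Num.conj (lam x) *: kernel_vec K (phi x);
  rp_kS : forall y, hfs_dom K y ->
    S (kernel_vec K y) = Num.conj (mu y) *: kernel_vec H (psi y)
}.

(** The infimum that defines delta_RK is the one of the products A * B over all A
    and B for which this holds. *)
Definition related H K (A B : R) := exists phi psi T S lam mu,
  @rk_pair H K A B phi psi T S lam mu.

Lemma rk_pair_sym H K A B phi psi T S lam mu :
  @rk_pair H K A B phi psi T S lam mu -> @rk_pair K H B A psi phi S T mu lam.
Proof. by case. Qed.

Lemma rk_pair_comp H K L A B phi psi T S lam mu A' B' phi' psi' T' S' lam' mu' :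
  @rk_pair H K A B phi psi T S lam mu ->
  @rk_pair K L A' B' phi' psi' T' S' lam' mu' ->
  @rk_pair H L (A' * A) (B * B') (phi' \o phi) (psi \o psi') (T' \o T) (S \o S')
    (fun x => lam x * lam' (phi x)) (fun z => mu' z * mu (psi' z)).
Proof.
move=> p q.
split=> /=.
- by move=> a f g; rewrite (rp_linT p) (rp_linT q).
- by move=> a f g; rewrite (rp_linS q) (rp_linS p).
- by move=> f /=; rewrite (rp_TK q) (rp_TK p).
- by move=> f /=; rewrite (rp_SK p) (rp_SK q).
- by rewrite mulr_ge0 ?(rp_A0 p) ?(rp_A0 q).
- by rewrite mulr_ge0 ?(rp_B0 p) ?(rp_B0 q).
- move=> f; apply: le_trans (rp_bT q _) _.
  by rewrite -mulrA ler_wpM2l ?(rp_A0 q) ?(rp_bT p).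
- move=> f; apply: le_trans (rp_bS p _) _.
  by rewrite -mulrA ler_wpM2l ?(rp_B0 p) ?(rp_bS q).
- by move=> x /(rp_phi p)/(rp_phi q).
- by move=> x /(rp_psi q)/(rp_psi p).
- by move=> x Hx; rewrite (rp_phiK q (rp_phi p Hx)) (rp_phiK p Hx).
- by move=> x Hx; rewrite (rp_psiK p (rp_psi q Hx)) (rp_psiK q Hx).
- by move=> x Hx; rewrite mulf_neq0 ?(rp_lam p Hx) ?(rp_lam q (rp_phi p Hx)).
- by move=> x Hx; rewrite mulf_neq0 ?(rp_mu q Hx) ?(rp_mu p (rp_psi q Hx)).
- move=> x Hx; rewrite (rp_kT p)// (scaleP (rp_linT q)).
  by rewrite (rp_kT q (rp_phi p Hx)) scalerA rmorphM.
- move=> x Hx; rewrite (rp_kS q)// (scaleP (rp_linS p)).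
  by rewrite (rp_kS p (rp_psi q Hx)) scalerA rmorphM.
Qed.

Lemma norm_le1 H (f : H) : (`|f| <= 1) = (rn f <= 1).
Proof. by rewrite rnE (lecR _ 1). Qed.

Lemma op_norm_le H K (T : H -> K) A : 0 <= A ->
  (forall f, rn (T f) <= A * rn f) -> (op_norm T <= A%:E)%E.
Proof.
move=> A0 bT; apply: ge_ereal_sup => _ [f /= f1 <-]; rewrite lee_fin.
by apply: le_trans (bT f) _; rewrite ler_piMr// -norm_le1.
Qed.

Lemma op_norm_ge0 H K (T : H -> K) : (0 <= op_norm T)%E.
Proof.
apply: le_trans (ereal_sup_ubound _); last by exists 0 => //=; rewrite normr0 ler01.
by rewrite lee_fin rn_ge0.
Qed.

Lemma op_norm_fin H K (T : H -> K) A :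
  (forall a f g, T (a *: f + g) = a *: T f + T g) ->
  (forall f, rn (T f) <= A * rn f) ->
  exists c, [/\ 0 <= c, op_norm T = c%:E & forall f, rn (T f) <= c * rn f].
Proof.
move=> lT bT.
have TZ := scaleP lT.
have T0 : T 0 = 0 by rewrite -(scale0r 0) TZ scale0r.
have le1 : (op_norm T <= `|A|%:E)%E.
  apply: op_norm_le => // f; apply: le_trans (bT f) _.
  by rewrite ler_wpM2r ?rn_ge0// ler_norm.
have fT : op_norm T \is a fin_num.
  by rewrite ge0_fin_numE ?op_norm_ge0// (le_lt_trans le1)// ltry.
exists (fine (op_norm T)); split; rewrite ?fineK// ?fine_ge0 ?op_norm_ge0//.
move=> f; have [->|f0] := eqVneq f 0; first by rewrite T0 !rn0 mulr0.
have fp : 0 < rn f by rewrite lt_def rn_eq0 f0 rn_ge0.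
rewrite -ler_pdivrMr// -lee_fin fineK//.
apply: ereal_sup_ubound; exists ((rn f)^-1%:C *: f) => /=.
  rewrite norm_le1 rnZ rn_real ger0_norm ?invr_ge0 ?rn_ge0//.
  by rewrite mulVf// gt_eqF.
rewrite TZ -/(rn _) rnZ rn_real ger0_norm ?invr_ge0 ?rn_ge0//.
by rewrite mulrC.
Qed.

Lemma delta_le H K A B : related H K A B -> (delta_RK H K <= (A * B)%:E)%E.
Proof.
move=> [phi [psi [T [S [lam [mu p]]]]]].
pose T' : {linear H -> K} := HB.pack T (GRing.isLinear.Build _ _ _ _ _ (rp_linT p)).
apply: (@le_trans _ _ (op_norm T * op_norm S)%E); last first.
  rewrite EFinM lee_pmul ?op_norm_ge0 ?op_norm_le ?(rp_A0 p) ?(rp_B0 p)//.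
    exact: rp_bT p.
  exact: rp_bS p.
apply: ereal_inf_lbound; exists T', S; split=> //; first last.
- exact: rp_SK p.
- exact: rp_TK p.
split.
- by exists S; [exact: rp_TK p | exact: rp_SK p].
- exists A => f; rewrite !rnE -rmorphM lecR; exact: rp_bT p f.
exists lam, phi; split; [exact: rp_lam p| |exact: rp_kT p].
split.
- by move=> x Hx; exact: (rp_phi p Hx).
- move=> x y /set_mem Hx /set_mem Hy e.
  by rewrite -(rp_phiK p Hx) e (rp_phiK p Hy).
- by move=> y Ky; exists (psi y); [exact: (rp_psi p Ky) | exact: (rp_psiK p Ky)].
Qed.

Lemma rk_iso_rk_pair H K (T : {linear H -> K}) (S : K -> H) :
  rk_iso T -> cancel T S -> cancel S T ->
  exists A B phi psi lam mu, [/\ op_norm T = A%:E, op_norm S = B%:E &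
    @rk_pair H K A B phi psi T S lam mu].
Proof.
move=> [_ [M bT] [lam [phi [lam0 [phiD phiI phiS] kT]]]] TK SK.
have linT a f g : T (a *: f + g) = a *: T f + T g by rewrite linearP.
have linS a f g : S (a *: f + g) = a *: S f + S g.
  by apply: (can_inj TK); rewrite SK linearP !SK.
have bT' f : rn (T f) <= M * rn f.
  by have := bT f; rewrite !rnE -rmorphM lecR.
have [B bS] := bounded_inverse linT bT' SK TK.
have [A' [A0 eA bA]] := op_norm_fin linT bT'.
have [B' [B0 eB bB]] := op_norm_fin linS bS.
have /choice[psi hpsi] : forall y, exists x, hfs_dom K y ->
    hfs_dom H x /\ phi x = y.
  move=> y; have [Ky|nK] := pselect (hfs_dom K y); last by exists y.
  by have [x Hx e] := phiS y Ky; exists x.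
pose mu y := (lam (psi y))^-1.
exists A', B', phi, psi, lam, mu; split=> //; split=> //.
- by move=> y /hpsi[].
- move=> x Hx; have [h1 h2] := hpsi _ (phiD _ Hx).
  by apply: phiI; rewrite ?inE.
- by move=> y /hpsi[].
- by move=> y /hpsi[h1 _]; rewrite invr_eq0 lam0.
- move=> y Ky; have [h1 h2] := hpsi _ Ky.
  apply: (can_inj TK); rewrite SK linearZ /= kT// h2 scalerA /mu fmorphV.
  by rewrite mulVf ?scale1r// conjC_eq0 lam0.
Qed.

Lemma delta_lt H K (c : R) : (delta_RK H K < c%:E)%E ->
  exists A B, related H K A B /\ A * B < c.
Proof.
move=> /ereal_inf_lt[_ [T [S [isoT TK SK ->]]]].
have [A [B [phi [psi [lam [mu [-> -> p]]]]]]] := rk_iso_rk_pair isoT TK SK.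
rewrite -EFinM lte_fin => AB; exists A, B; split=> //.
by exists phi, psi, T, S, lam, mu.
Qed.

Lemma related_ge1 H K A B (f : H) : f != 0 -> related H K A B -> 1 <= A * B.
Proof.
move=> f0 [phi [psi [T [S [lam [mu p]]]]]].
have fp : 0 < rn f by rewrite lt_def rn_eq0 f0 rn_ge0.
rewrite -(ler_pM2r fp) mul1r -{1}(rp_TK p f) mulrAC mulrC.
by apply: le_trans (rp_bS p _) _; rewrite ler_wpM2l ?(rp_B0 p) ?(rp_bT p).
Qed.

Lemma related_sym H K A B : related H K A B -> related K H B A.
Proof.
by move=> [phi [psi [T [S [lam [mu /rk_pair_sym p]]]]]]; exists psi, phi, S, T, mu, lam.
Qed.

Lemma related_comp H K L A B A' B' : related H K A B -> related K L A' B' ->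
  related H L (A' * A) (B * B').
Proof.
move=> [phi [psi [T [S [lam [mu p]]]]]] [phi' [psi' [T' [S' [lam' [mu' p']]]]]].
have q := rk_pair_comp p p'.
by do 6 eexists; exact: q.
Qed.

Lemma same_hfs_related H K : same_hfs H K -> related H K 1 1.
Proof.
move=> [eD [J [[S JK SK] eJ dJ]]].
have linJ a f g : J (a *: f + g) = a *: J f + J g.
  apply: hfs_ev_inj => x; rewrite -eD => Hx.
  have Kx : hfs_dom K x by rewrite -eD.
  by rewrite eJ// !hfs_ev_linear// !eJ.
have linS a f g : S (a *: f + g) = a *: S f + S g.
  by apply: (can_inj JK); rewrite SK linJ !SK.
have nJ f : rn (J f) = rn f.
  by apply: (@pexpIrn _ 2); rewrite ?nnegrE ?rn_ge0// !rn_sqr dJ.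
have kJ x : hfs_dom H x -> J (kernel_vec H x) = kernel_vec K x.
  move=> Hx; have Kx : hfs_dom K x by rewrite -eD.
  by apply: dot_eqP => g; rewrite -(SK g) dJ -!kernel_vecP// eJ.
exists id, id, J, S, (fun=> 1), (fun=> 1); split=> //.
- by move=> f; rewrite mul1r nJ.
- by move=> f; rewrite mul1r -{2}(SK f) nJ.
- by rewrite eD.
- by rewrite eD.
- by move=> x Hx; rewrite rmorph1 scale1r kJ.
- move=> x; rewrite -eD => Hx.
  by rewrite rmorph1 scale1r -kJ// JK.
Qed.

(** By delta_le and delta_lt, each axiom is a statement about the products A * B
    for related spaces. Only definiteness is left to the geometry of the spaces. *)
Lemma rho_metric (C : hilbert_function_space R X -> Prop) :
  (forall H, C H -> exists f : H, f != 0) ->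
  (forall H K, C H -> C K -> exists A B, related H K A B) ->
  (forall H K, C H -> C K ->
    (forall e, 0 < e -> exists A B, related H K A B /\ A * B < 1 + e) ->
    same_hfs H K) ->
  metric_on C (@same_hfs R X) (@rho_RK R X).
Proof.
move=> n0 rel def.
have ge1 H K : C H -> C K -> (1 <= delta_RK H K)%E.
  move=> CH CK; rewrite leNgt; apply/negP => /delta_lt[A [B [r lt1]]].
  have [f f0] := n0 _ CH.
  by have := related_ge1 f0 r; rewrite leNgt lt1.
have fin H K : C H -> C K -> delta_RK H K \is a fin_num.
  move=> CH CK; have [A [B r]] := rel _ _ CH CK.
  rewrite ge0_fin_numE ?(le_trans _ (ge1 _ _ CH CK))//.
  by rewrite (le_lt_trans (delta_le r))// ltry.
have le_sym H K : C H -> C K -> (delta_RK H K <= delta_RK K H)%E.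
  move=> CH CK; rewrite -[leRHS]fineK ?fin//; apply/lee_addgt0Pr => e e0.
  have [|A [B [r lt1]]] := @delta_lt K H (fine (delta_RK K H) + e).
    by rewrite -[ltLHS]fineK ?fin// lte_fin ltrDl.
  apply: le_trans (delta_le (related_sym r)) _.
  by rewrite lee_fin mulrC ltW.
have gt0 H K : C H -> C K -> delta_RK H K \in `]0%E, +oo%E].
  by move=> CH CK; rewrite in_itv /= leey andbT (lt_le_trans _ (ge1 _ _ CH CK)).
split.
- move=> H K CH CK; have := ge1 _ _ CH CK; rewrite /rho_RK -(fineK (fin _ _ CH CK)).
  by rewrite lee_fin => h; rewrite lne_EFin// (lt_le_trans _ h).
- by move=> H K CH CK; rewrite /rho_RK lne_ge0 ge1.
- move=> H K CH CK; split.
    move=> /eqP; rewrite lne_eq0 => /eqP d1; apply: def => // e e0.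
    by apply: delta_lt; rewrite d1 lte_fin ltrDl.
  move=> /same_hfs_related/delta_le; rewrite mulr1 => le1.
  by apply/eqP; rewrite lne_eq0 eq_le le1 ge1.
- by move=> H K CH CK; congr lne; apply/eqP; rewrite eq_le !le_sym.
- move=> H K L CH CK CL; rewrite /rho_RK -lneM ?gt0//.
  rewrite lee_lne ?in_itv/= ?leey ?andbT; first last.
  + by rewrite mule_ge0// (le_trans _ (ge1 _ _ _ _)).
  + by rewrite (le_trans _ (ge1 _ _ _ _)).
  have fHK := fin _ _ CH CK; have fKL := fin _ _ CK CL.
  have fHL := fin _ _ CH CL.
  rewrite -(fineK fHL) -(fineK fHK) -(fineK fKL) -EFinM lee_fin.
  have a1 : 1 <= fine (delta_RK H K) by rewrite -lee_fin fineK// ge1.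
  have b1 : 1 <= fine (delta_RK K L) by rewrite -lee_fin fineK// ge1.
  have near (H1 H2 : hilbert_function_space R X) (e : R) : C H1 -> C H2 -> 0 < e ->
      exists A B, related H1 H2 A B /\ A * B < fine (delta_RK H1 H2) + e.
    move=> C1 C2 e0; apply: delta_lt.
    by rewrite -[ltLHS]fineK ?fin// lte_fin ltrDl.
  set a := fine (delta_RK H K) in a1 *; set b := fine (delta_RK K L) in b1 *.
  apply/ler_addgt0Pr => e e0.
  pose e' := Num.min 1 (e / (1 + a + b)).
  have s0 : 0 < 1 + a + b by lra.
  have e'0 : 0 < e' by rewrite lt_min ltr01 divr_gt0.
  have e'1 : e' <= 1 by rewrite ge_min lexx.
  have e'e : e' * (1 + a + b) <= e by rewrite -ler_pdivlMr// ge_min lexx orbT.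
  have [A [B [r1 l1]]] := near _ _ _ CH CK e'0.
  have [A' [B' [r2 l2]]] := near _ _ _ CK CL e'0.
  have := delta_le (related_comp r1 r2).
  rewrite -(fineK fHL) lee_fin => /le_trans; apply.
  have [f f0] := n0 _ CH; have [g g0] := n0 _ CK.
  have g1 := related_ge1 f0 r1; have g2 := related_ge1 g0 r2.
  rewrite -/a -/b in l1 l2.
  rewrite (_ : A' * A * (B * B') = (A * B) * (A' * B')); last by ring.
  apply: (@le_trans _ _ ((a + e') * (b + e'))); last by nra.
  by apply: ler_pM; [exact: le_trans g1|exact: le_trans g2|exact: ltW|exact: ltW].
Qed.

End KernelIsomorphisms.

(** * Isomorphisms induced by maps of the domains *)

Section KernelUnitary.
Variables (R : realType) (X : Type).
Implicit Types H K : hilbert_function_space R X.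

Lemma kcomb_cons H c s : kcomb H (c :: s) = c.1 *: kernel_vec H c.2 + kcomb H s.
Proof. by rewrite /kcomb big_cons. Qed.

Lemma half_gt0 (e : R) : 0 < e -> 0 < e / 2.
Proof. by move=> e0; rewrite divr_gt0. Qed.

Lemma small_eq (z : R[i]) : (forall e, 0 < e -> rn z <= e) -> z = 0.
Proof.
move=> h; apply/eqP; rewrite -rn_eq0 eq_le rn_ge0 andbT.
by apply/ler_addgt0Pr => e /h; rewrite add0r.
Qed.

(** Polarization: the real part comes from |f + g|, and the imaginary part from
    the real part for i f and g. *)
Lemma isometry_dot H K (T : H -> K) :
  (forall a f g, T (a *: f + g) = a *: T f + T g) ->
  (forall f, rn (T f) = rn f) ->
  forall f g, hfs_dot K (T f) (T g) = hfs_dot H f g.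
Proof.
move=> lT nT.
have eRe f g : complex.Re (hfs_dot K (T f) (T g)) = complex.Re (hfs_dot H f g).
  have := nT (f + g); rewrite -[f]scale1r lT !scale1r => /(congr1 (fun z => z ^+ 2)).
  by rewrite !rnD_sqr !nT => /addrI/mulfI; apply; rewrite pnatr_eq0.
move=> f g; have := eRe ('i *: f) g; rewrite (scaleP lT) !dotZl.
move: (eRe f g); case: (hfs_dot _ _ _) => a b; case: (hfs_dot _ _ _) => c d /= ->.
by rewrite !mul0r !mul1r !sub0r => /oppr_inj ->.
Qed.

(** The vector f is a limit of combinations of kernel vectors; transporting the
    points by phi preserves inner products of such combinations, hence Cauchy
    sequences of them. *)
Lemma transport_exists H K (phi : X -> X) :
  (forall x, hfs_dom H x -> hfs_dom K (phi x)) ->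
  (forall x y, hfs_dom H x -> hfs_dom H y ->
    hfs_dot K (kernel_vec K (phi x)) (kernel_vec K (phi y)) =
    hfs_dot H (kernel_vec H x) (kernel_vec H y)) ->
  forall f : H, exists g : K, rn g <= rn f /\
    forall x, hfs_dom H x ->
      hfs_dot K g (kernel_vec K (phi x)) = hfs_dot H f (kernel_vec H x).
Proof.
move=> phiD ek f.
pose c2 s := kcomb K [seq (c.1, phi c.2) | c <- s].
have c2_cons c s : c2 (c :: s) = c.1 *: kernel_vec K (phi c.2) + c2 s.
  by rewrite /c2 /= kcomb_cons.
have ev2 s x : pts_in H s -> hfs_dom H x ->
    hfs_dot K (c2 s) (kernel_vec K (phi x)) = hfs_dot H (kcomb H s) (kernel_vec H x).
  move=> + Hx; elim: s => [|c s IH] sP.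
    by rewrite /c2 /kcomb !big_nil !dot0l.
  rewrite c2_cons kcomb_cons !dotDl !dotZl ek//; last by apply: sP; left.
  by rewrite IH// => b bs; apply: sP; right.
have dot2 s t : pts_in H s -> pts_in H t ->
    hfs_dot K (c2 s) (c2 t) = hfs_dot H (kcomb H s) (kcomb H t).
  move=> sP; elim: t => [|c t IH] tP.
    by rewrite /c2 /kcomb !big_nil !dot0r.
  rewrite c2_cons kcomb_cons !dotDr !dotZr ev2//; last by apply: tP; left.
  by rewrite IH// => b bs; apply: tP; right.
have n2 s : pts_in H s -> rn (c2 s) = rn (kcomb H s).
  move=> sP; apply: (@pexpIrn _ 2); rewrite ?nnegrE ?rn_ge0// !rn_sqr.
  by rewrite dot2.
have nB s t : pts_in H s -> pts_in H t ->
    rn (c2 s - c2 t) = rn (kcomb H s - kcomb H t).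
  move=> sP tP; apply: (@pexpIrn _ 2); rewrite ?nnegrE ?rn_ge0// !rnB_sqr.
  by rewrite !n2// dot2.
have /choice[s sP] : forall n, exists s, pts_in H s /\ rn (f - kcomb H s) < n.+1%:R^-1.
  move=> n; have n0 : 0 < n.+1%:R^-1 :> R by rewrite invr_gt0.
  by have [s sP hs] := kcomb_dense f n0; exists s.
have [g hg] : exists g : K, forall e, 0 < e ->
    exists N, forall n, (N <= n)%N -> rn (c2 (s n) - g) < e.
  apply: hilbert_complete => e e0.
  have [N hN] := invS_lt (half_gt0 e0).
  exists N => m n /hN hm /hN hn; have [s1 d1] := sP m; have [s2 d2] := sP n.
  rewrite nB//; apply: le_lt_trans (rn_triangle f _ _) _.
  by rewrite rnBC; move: (lt_trans d1 hm) (lt_trans d2 hn); clear; lra.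
have key e : 0 < e -> exists t, [/\ pts_in H t, rn (c2 t - g) < e & rn (f - kcomb H t) < e].
  move=> e0; have [N1 h1] := hg _ e0; have [N2 h2] := invS_lt e0.
  have [sm d] := sP (maxn N1 N2).
  exists (s (maxn N1 N2)); split => //; first by apply: h1; rewrite leq_maxl.
  by apply: lt_trans d _; apply: h2; rewrite leq_maxr.
exists g; split.
  apply/ler_addgt0Pr => e e0.
  have [t [tP d1 d2]] := key _ (half_gt0 e0).
  have h1 := rnB (c2 t) (c2 t - g); have h2 := rnB f (f - kcomb H t).
  by rewrite subKr n2// in h1; rewrite subKr in h2; lra.
move=> x Hx; apply/eqP; rewrite -subr_eq0; apply/eqP/small_eq => e e0.
pose M := 1 + rn (kernel_vec K (phi x)) + rn (kernel_vec H x).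
have M0 : 0 < M by rewrite !ltr_pwDl ?rn_ge0.
have [t [tP d1 d2]] := key _ (divr_gt0 e0 M0).
apply: le_trans (rn_triangle (hfs_dot K (c2 t) (kernel_vec K (phi x))) _ _) _.
rewrite {2}ev2// -!dotBl.
apply: le_trans (lerD (dot_CS _ _) (dot_CS _ _)) _.
rewrite rnBC [rn (kcomb _ _ - f)]rnBC.
have a0 := rn_ge0 (kernel_vec K (phi x)); have b0 := rn_ge0 (kernel_vec H x).
apply: (@le_trans _ _ (e / M * rn (kernel_vec K (phi x)) + e / M * rn (kernel_vec H x))).
  by apply: lerD; rewrite ler_wpM2r// ltW.
rewrite -mulrDr mulrAC ler_pdivrMr// ler_pM2l// /M; lra.
Qed.

(** The two operators transport functions along phi and along its inverse; as a
    function is determined by its values, they are linear and inverse to each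
    other. *)
Lemma kernel_unitary H K (phi psi : X -> X) :
  (forall x, hfs_dom H x -> hfs_dom K (phi x)) ->
  (forall y, hfs_dom K y -> hfs_dom H (psi y)) ->
  (forall x, hfs_dom H x -> psi (phi x) = x) ->
  (forall y, hfs_dom K y -> phi (psi y) = y) ->
  (forall x y, hfs_dom H x -> hfs_dom H y ->
    hfs_dot K (kernel_vec K (phi x)) (kernel_vec K (phi y)) =
    hfs_dot H (kernel_vec H x) (kernel_vec H y)) ->
  exists T S, @rk_pair R X H K 1 1 phi psi T S (fun=> 1) (fun=> 1).
Proof.
move=> phiD psiD phiK psiK ek.
have ek' x y : hfs_dom K x -> hfs_dom K y ->
    hfs_dot H (kernel_vec H (psi x)) (kernel_vec H (psi y)) =
    hfs_dot K (kernel_vec K x) (kernel_vec K y).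
  by move=> Kx Ky; rewrite -ek ?psiK//; exact: psiD.
have /choice[T hT] := transport_exists phiD ek.
have /choice[S hS] := transport_exists psiD ek'.
have eT f y : hfs_dom K y ->
    hfs_dot K (T f) (kernel_vec K y) = hfs_dot H f (kernel_vec H (psi y)).
  by move=> Ky; rewrite -[in LHS](psiK y Ky) (hT f).2//; exact: psiD.
have eS g x : hfs_dom H x ->
    hfs_dot H (S g) (kernel_vec H x) = hfs_dot K g (kernel_vec K (phi x)).
  by move=> Hx; rewrite -[in LHS](phiK x Hx) (hS g).2//; exact: phiD.
exists T, S; split=> //.
- move=> a f g; apply: dot_kernel_eq => y Ky.
  by rewrite dotDl dotZl !eT// dotDl dotZl.
- move=> a f g; apply: dot_kernel_eq => y Ky.
  by rewrite dotDl dotZl !eS// dotDl dotZl.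
- by move=> f; apply: dot_kernel_eq => x Hx; rewrite eS// eT ?phiK//; exact: phiD.
- by move=> f; apply: dot_kernel_eq => x Hx; rewrite eT// eS ?psiK//; exact: psiD.
- by move=> f; rewrite mul1r (hT f).1.
- by move=> f; rewrite mul1r (hS f).1.
- move=> x Hx; rewrite rmorph1 scale1r; apply: dot_kernel_eq => y Ky.
  by rewrite eT// -{2}(psiK y Ky) ek//; exact: psiD.
- move=> x Kx; rewrite rmorph1 scale1r; apply: dot_kernel_eq => y Hy.
  by rewrite eS// -{2}(phiK y Hy) ek'//; exact: phiD.
Qed.

Lemma kernel_eq_same H K : hfs_dom H = hfs_dom K ->
  (forall x y, hfs_dom H x -> hfs_dom H y ->
    hfs_dot K (kernel_vec K x) (kernel_vec K y) =
    hfs_dot H (kernel_vec H x) (kernel_vec H y)) -> same_hfs H K.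
Proof.
move=> eD ek.
have [T [S p]] : exists T S, @rk_pair R X H K 1 1 id id T S (fun=> 1) (fun=> 1).
  by apply: kernel_unitary => //; rewrite eD.
have nT f : rn (T f) = rn f.
  apply/eqP; rewrite eq_le; apply/andP; split.
    by rewrite -[leRHS]mul1r (rp_bT p).
  by rewrite -{1}(rp_TK p f) -[leRHS]mul1r (rp_bS p).
split=> //; exists T; split.
- by exists S; [exact: rp_TK p | exact: rp_SK p].
- move=> f x Hx; have Kx : hfs_dom K x by rewrite -eD.
  by rewrite !kernel_vecP// -[RHS](isometry_dot (rp_linT p) nT) (rp_kT p)//
     rmorph1 scale1r.
- by move=> f g; apply: isometry_dot => //; exact: rp_linT p.
Qed.

End KernelUnitary.

(** * Series, and the Hermitian product *)

Section ComplexSeries.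
Variable R : realType.

Lemma rn_cvg (u : nat -> R[i]) l : u @ \oo --> l ->
  (fun n => rn (u n)) @ \oo --> rn l.
Proof.
move=> /cvgrPdist_lt ul; apply/cvgrPdist_lt => e e0.
have [N _ hN] := ul e%:C ltac:(by rewrite ltcR).
exists N => // n /hN /=; rewrite rnE ltcR; apply: le_lt_trans.
exact: ler_rn_dist.
Qed.

Lemma Re_cvg (u : nat -> R[i]) l : u @ \oo --> l ->
  (fun n => complex.Re (u n)) @ \oo --> complex.Re l.
Proof.
move=> /cvgrPdist_lt ul; apply/cvgrPdist_lt => e e0.
have [N _ hN] := ul e%:C ltac:(by rewrite ltcR).
exists N => // n /hN /=; rewrite rnE ltcR; apply: le_lt_trans.
by rewrite -Re_sub ler_Re_rn.
Qed.

Lemma series_rn_le (c : nat -> R[i]) (e : nat -> R) l s :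
  series c @ \oo --> l -> series e @ \oo --> s ->
  (forall n, rn (c n) <= e n) -> rn l <= s.
Proof.
move=> cl es le; apply: (ler_cvg_to (rn_cvg cl) es).
apply: nearW => N; rewrite /series /=; elim: N => [|N IH].
  by rewrite !big_geq// rn0.
by rewrite !big_nat_recr//=; apply: le_trans (rnD _ _) _; rewrite lerD.
Qed.

Lemma series_le (c e : nat -> R) l s :
  series c @ \oo --> l -> series e @ \oo --> s ->
  (forall n, c n <= e n) -> l <= s.
Proof.
move=> cl es le; apply: (ler_cvg_to cl es); apply: nearW => N.
by rewrite /series /= ler_sum.
Qed.

Lemma series_ge_term (e : nat -> R) s n :
  series e @ \oo --> s -> (forall n, 0 <= e n) -> e n <= s.
Proof.
move=> es e0; apply: le_trans (_ : series e n.+1 <= s).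
  by rewrite /series /= big_nat_recr//= lerDr sumr_ge0.
have nd : nondecreasing_seq (series e).
  by apply/nondecreasing_seqP => k; rewrite /series /= big_nat_recr//= lerDl.
rewrite -(cvg_lim _ es)//; apply: nondecreasing_cvgn_le => //.
by apply/cvg_ex; exists s.
Qed.

Lemma series_scale (e : nat -> R) s k :
  series e @ \oo --> s -> series (fun n => k * e n) @ \oo --> k * s.
Proof.
move=> es; have -> : series (fun n => k * e n) = (fun n => k * series e n).
  by apply/funext => n; rewrite /series /= mulr_sumr.
exact: cvgMr.
Qed.

End ComplexSeries.

Section HermitianProduct.
Variables (R : realType) (d : nat).
Implicit Types (x y z w : 'rV[R[i]]_d) (a : R[i]).

Lemma cdotC z w : cdot w z = Num.conj (cdot z w).
Proof.
rewrite /cdot rmorph_sum; apply: eq_bigr => i _.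
by rewrite rmorphM /= conjCK mulrC.
Qed.

Lemma cdotDl x y w : cdot (x + y) w = cdot x w + cdot y w.
Proof. by rewrite /cdot -big_split; apply: eq_bigr => i _; rewrite mxE mulrDl. Qed.

Lemma cdotZl a z w : cdot (a *: z) w = a * cdot z w.
Proof. by rewrite /cdot mulr_sumr; apply: eq_bigr => i _; rewrite mxE mulrA. Qed.

Lemma cdotNl z w : cdot (- z) w = - cdot z w.
Proof. by rewrite -scaleN1r cdotZl mulN1r. Qed.

Lemma cdotDr x y w : cdot w (x + y) = cdot w x + cdot w y.
Proof. by rewrite cdotC cdotDl rmorphD /= -!cdotC. Qed.

Lemma cdotZr a z w : cdot w (a *: z) = Num.conj a * cdot w z.
Proof. by rewrite cdotC cdotZl rmorphM /= -cdotC. Qed.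

Lemma cdotNr z w : cdot w (- z) = - cdot w z.
Proof. by rewrite cdotC cdotNl rmorphN /= -cdotC. Qed.

Lemma cdot0l w : cdot 0 w = 0.
Proof. by rewrite -(scale0r (0 : 'rV[R[i]]_d)) cdotZl mul0r. Qed.

Lemma cdot0r w : cdot w 0 = 0.
Proof. by rewrite cdotC cdot0l rmorph0. Qed.

Lemma cdot_ge0 z : 0 <= complex.Re (cdot z z).
Proof.
rewrite /cdot; elim/big_ind: _ => // [x y x0 y0|i _].
  by rewrite Re_add addr_ge0.
by rewrite mulr_conj /= exprn_ge0// rn_ge0.
Qed.

Lemma cnorm_ge0 z : 0 <= cnorm z.
Proof. exact: sqrtr_ge0. Qed.

Lemma cnorm_sqr z : cnorm z ^+ 2 = complex.Re (cdot z z).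
Proof. by rewrite sqr_sqrtr ?cdot_ge0. Qed.

Lemma cdot_self z : cdot z z = (cnorm z ^+ 2)%:C.
Proof.
rewrite cnorm_sqr RRe_real//; apply/CrealP.
by rewrite -cdotC.
Qed.

Lemma cnorm0 : cnorm (0 : 'rV[R[i]]_d) = 0.
Proof. by rewrite /cnorm cdot0l sqrtr0. Qed.

Lemma cnorm_eq0 z : cnorm z = 0 -> z = 0.
Proof.
move=> z0; apply/rowP => i; rewrite mxE; apply/eqP.
have : complex.Re (cdot z z) = 0 by rewrite -cnorm_sqr z0 expr0n.
rewrite /cdot (bigD1 i)//= Re_add mulr_conj /= => /eqP.
rewrite paddr_eq0 ?exprn_ge0 ?rn_ge0//; last first.
  elim/big_ind: _ => // [x y x0 y0|j _]; first by rewrite Re_add addr_ge0.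
  by rewrite mulr_conj /= exprn_ge0// rn_ge0.
by rewrite expf_eq0 rn_eq0 => /andP[].
Qed.

Lemma cnormZ a z : cnorm (a *: z) = rn a * cnorm z.
Proof.
apply: (@pexpIrn _ 2); rewrite ?nnegrE ?mulr_ge0 ?rn_ge0 ?cnorm_ge0//.
by rewrite cnorm_sqr cdotZl cdotZr mulrA mulr_conj cdot_self exprMn -rmorphM.
Qed.

Lemma point_of_norm (s : R) : (0 < d)%N -> 0 <= s ->
  exists x : 'rV[R[i]]_d, cnorm x = s.
Proof.
move=> d0 s0; pose i0 : 'I_d := Ordinal d0.
exists (s%:C *: delta_mx 0 i0).
rewrite cnormZ rn_real ger0_norm// [cnorm _](_ : _ = 1) ?mulr1//.
rewrite /cnorm /cdot (bigD1 i0)//= big1 ?addr0; last first.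
  by move=> i ii0; rewrite !mxE eqxx /= (negbTE ii0) mul0r.
by rewrite mulr_conj mxE !eqxx rn1 expr1n /= sqrtr1.
Qed.

Lemma cdot_CS z w : rn (cdot z w) <= cnorm z * cnorm w.
Proof.
rewrite -(@ler_pXn2r _ 2%N) ?nnegrE ?mulr_ge0 ?rn_ge0 ?cnorm_ge0// exprMn.
have [w0|w0] := eqVneq (cnorm w) 0.
  by rewrite (cnorm_eq0 w0) cdot0r rn0 cnorm0 expr0n mulr0.
have G0 : 0 < cnorm w ^+ 2 by rewrite exprn_gt0// lt_def w0 cnorm_ge0.
have := cdot_ge0 ((cnorm w ^+ 2)%:C *: z - cdot z w *: w).
rewrite !(cdotDl, cdotDr, cdotNl, cdotNr, cdotZl, cdotZr) !cdot_self.
rewrite !conj_real (cdotC z w); set c := cdot z w.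
rewrite [X in complex.Re X](_ : _ = (cnorm w ^+ 2)%:C *
  ((cnorm w ^+ 2)%:C * (cnorm z ^+ 2)%:C - c * Num.conj c)); last by ring.
rewrite mulr_conj -!rmorphM -!rmorphB -rmorphM /= pmulr_rge0// subr_ge0.
by rewrite mulrC.
Qed.

End HermitianProduct.

(** * The kernel of a weighted Hardy space *)

Section HardyKernel.
Variables (R : realType) (d : nat) (r : R).
Local Notation V := ('rV[R[i]]_d).
Local Notation space := (hilbert_function_space R V).

(** The analytic content of weighted_hardy: the power series of the kernel, and
    the continuity of the functions up to the part of the sphere in the domain. *)
Record hardy (a : nat -> R) (H : space) : Prop := Hardy {
  hardy0 : a 0%N = 1;
  hardy_gt0 : forall n, 0 < a n;
  hardy_radius : conv_radius a = (r ^+ 2)%:E;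
  hardy_dom : hfs_dom H = natural_domain r a;
  hardy_ker : forall z w, hfs_dom H z -> hfs_dom H w ->
    series (fun n => (a n)%:C * cdot z w ^+ n) @ \oo
      --> hfs_dot H (kernel_vec H w) (kernel_vec H z);
  hardy_cont : forall f : H, {within hfs_dom H, continuous (hfs_ev f)}
}.

Lemma weighted_hardyP H : weighted_hardy r H -> exists a, hardy a H.
Proof.
move=> [a [m [[[a0 ap _] rad dom ker] fc _ _ _]]]; exists a.
have kerH z w : hfs_dom H z -> hfs_dom H w ->
    series (fun n => (a n)%:C * cdot z w ^+ n) @ \oo
      --> hfs_dot H (kernel_vec H w) (kernel_vec H z).
  by move=> Hz Hw; rewrite -kernel_vecP//; exact: ker.
exact: (Hardy a0 ap rad dom kerH (fun f => (fc f).2)).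
Qed.

Section OneSpace.
Hypothesis r0 : 0 < r.
Variables (a : nat -> R) (H : space).
Hypothesis hH : hardy a H.
Local Notation dom := (hfs_dom H).
Local Notation k := (kernel_vec H).
Implicit Types x y : V.

Lemma hardy_domE x : dom x <->
  cnorm x < r \/ (cnorm x <= r /\ cvgn (pseries a (r ^+ 2))).
Proof.
rewrite (hardy_dom hH) /natural_domain; case: asboolP => [c|nc] /=.
  by split=> [le|[/ltW//|[]//]]; right.
by split=> [|[//|[_ /nc]]//]; left.
Qed.

Lemma dom_le x y : dom x -> cnorm y <= cnorm x -> dom y.
Proof.
rewrite !hardy_domE => -[lt|[le c]] yx; first by left; exact: le_lt_trans lt.
by right; split=> //; exact: le_trans le.
Qed.

Lemma dom_ball x : cnorm x < r -> dom x.
Proof. by rewrite hardy_domE; left. Qed.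

Lemma dom0 : dom 0.
Proof. by apply: dom_ball; rewrite cnorm0. Qed.

Lemma dom_scale c x : rn c <= 1 -> dom x -> dom (c *: x).
Proof.
by move=> c1 /dom_le; apply; rewrite cnormZ ler_piMl// cnorm_ge0.
Qed.

(** The kernel on the diagonal, that is rn (k x) ^+ 2, is the value of the
    generating function at |x|^2; G refers to this function of x. *)
Lemma G_series x : dom x ->
  series (fun n => a n * (cnorm x ^+ 2) ^+ n) @ \oo --> rn (k x) ^+ 2.
Proof.
move=> Hx; have := Re_cvg (hardy_ker hH Hx Hx); rewrite -rn_sqr.
set u := (u in u @ _); suff -> : u = series (fun n => a n * (cnorm x ^+ 2) ^+ n) by [].
apply/funext => N; rewrite /u /series /=; elim: N => [|N IH]; first by rewrite !big_geq.
by rewrite !big_nat_recr//= Re_add IH cdot_self -rmorphXn -rmorphM.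
Qed.

Lemma G_term_ge0 x n : 0 <= a n * (cnorm x ^+ 2) ^+ n.
Proof. by rewrite mulr_ge0 ?exprn_ge0 ?cnorm_ge0// ltW// (hardy_gt0 hH). Qed.

(** As all coefficients are positive, the term of degree one alone is a lower
    bound for the increase of the kernel on the diagonal. *)
Lemma G_sub x y : dom x -> dom y -> cnorm x <= cnorm y ->
  a 1%N * (cnorm y ^+ 2 - cnorm x ^+ 2) <= rn (k y) ^+ 2 - rn (k x) ^+ 2.
Proof.
move=> Hx Hy xy; have xy2 : cnorm x ^+ 2 <= cnorm y ^+ 2.
  by rewrite ler_pXn2r ?nnegrE ?cnorm_ge0.
pose e n := a n * (cnorm y ^+ 2) ^+ n - a n * (cnorm x ^+ 2) ^+ n.
have es : series e @ \oo --> rn (k y) ^+ 2 - rn (k x) ^+ 2.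
  have -> : series e = series (fun n => a n * (cnorm y ^+ 2) ^+ n) -
                       series (fun n => a n * (cnorm x ^+ 2) ^+ n).
    by apply/funext => n; rewrite /series /= sumrB.
  by apply: cvgB; apply: G_series.
have e0 n : 0 <= e n.
  rewrite subr_ge0 ler_pM2l ?(hardy_gt0 hH)//.
  by rewrite lerXn2r// nnegrE exprn_ge0// cnorm_ge0.
have := series_ge_term 1 es e0.
by rewrite /e !expr1 -mulrBr.
Qed.

Lemma G_le x y : dom y -> cnorm x <= cnorm y -> rn (k x) ^+ 2 <= rn (k y) ^+ 2.
Proof.
move=> Hy xy; have Hx := dom_le Hy xy.
rewrite -subr_ge0; apply: le_trans (G_sub Hx Hy xy).
rewrite mulr_ge0 ?subr_ge0 ?(ltW (hardy_gt0 hH _))//.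
by rewrite ler_pXn2r ?nnegrE ?cnorm_ge0.
Qed.

Lemma G_lt x y : dom x -> dom y -> rn (k x) ^+ 2 < rn (k y) ^+ 2 ->
  cnorm x < cnorm y.
Proof.
by move=> Hx Hy; rewrite !ltNge; apply: contra => /(G_le Hx).
Qed.

Lemma G_inj x y : dom x -> dom y -> rn (k x) ^+ 2 = rn (k y) ^+ 2 ->
  cnorm x = cnorm y.
Proof.
wlog xy : x y / cnorm x <= cnorm y => [wl Hx Hy e|Hx Hy e].
  by have [/wl->//|/ltW/wl->] := leP (cnorm x) (cnorm y).
have := G_sub Hx Hy xy; rewrite e subrr pmulr_rle0 ?(hardy_gt0 hH)// subr_le0.
rewrite ler_pXn2r ?nnegrE ?cnorm_ge0// => yx.
by apply/eqP; rewrite eq_le xy yx.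
Qed.

Lemma dot_k0 x : dom x -> hfs_dot H (k 0) (k x) = 1.
Proof.
move=> Hx; have kc := hardy_ker hH Hx dom0.
have c1 : series (fun n => (a n)%:C * cdot x 0 ^+ n) @ \oo --> (1 : R[i]).
  apply: cvg_near_cst; exists 1%N => // n /= n1.
  rewrite /series /= -(prednK n1) big_nat_recl//= expr0 mulr1 (hardy0 hH).
  by rewrite big1 ?addr0// => i _; rewrite cdot0r expr0n /= mulr0.
exact: (cvg_unique (@norm_hausdorff _ _) kc c1).
Qed.

Lemma rn_k0 : rn (k 0) = 1.
Proof.
apply: (@pexpIrn _ 2); rewrite ?nnegrE ?rn_ge0//.
by rewrite rn_sqr dot_k0 ?expr1n//; exact: dom0.
Qed.

Lemma G_ge1 x : dom x -> 1 <= rn (k x) ^+ 2.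
Proof.
move=> Hx; rewrite -[leLHS](expr1n _ 2) -rn_k0; apply: G_le => //.
by rewrite cnorm0 cnorm_ge0.
Qed.

(** A pair (c, z) of the list s stands for the kernel vector at the point z x of
    the line through x, with weight c. In the homogeneous expansion of k x, the
    part of degree m gets multiplied by coef s m. *)
Definition comb (s : seq (R[i] * R[i])) x : H :=
  \sum_(c <- s) c.1 *: k (c.2 *: x).

Definition coef (s : seq (R[i] * R[i])) (m : nat) : R[i] :=
  \sum_(c <- s) c.1 * Num.conj c.2 ^+ m.

Definition in_disc (s : seq (R[i] * R[i])) := all (fun c => rn c.2 <= 1) s.

Lemma comb_kernel s x y : in_disc s -> dom x -> dom y ->
  series (fun m => (a m)%:C * (coef s m * cdot y x ^+ m)) @ \oo
    --> hfs_dot H (comb s x) (k y).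
Proof.
move=> + Hx Hy; elim: s => [_|c s IH /andP[c1 s1]].
  rewrite /comb big_nil dot0l; apply: cvg_near_cst; apply: nearW => n.
  by rewrite /series /= big1// => i _; rewrite /coef big_nil mul0r mulr0.
rewrite /comb big_cons dotDl dotZl.
have Hcx := dom_scale c1 Hx.
have -> : series (fun m => (a m)%:C * (coef (c :: s) m * cdot y x ^+ m)) =
  (fun n => c.1 * series (fun m => (a m)%:C * cdot y (c.2 *: x) ^+ m) n +
    series (fun m => (a m)%:C * (coef s m * cdot y x ^+ m)) n).
  apply/funext => n; rewrite /series /= mulr_sumr -big_split.
  apply: eq_bigr => m _; rewrite /coef big_cons cdotZr exprMn /=.
  by ring.
apply: cvgD; last exact: IH.
exact: (cvgZr (hardy_ker hH Hy Hcx)).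
Qed.

Lemma comb_dot s t x : in_disc s -> in_disc t -> dom x ->
  series (fun m => (a m)%:C * (coef s m * Num.conj (coef t m) *
      ((cnorm x ^+ 2) ^+ m)%:C)) @ \oo
    --> hfs_dot H (comb s x) (comb t x).
Proof.
move=> sD + Hx; elim: t => [_|c t IH /andP[c1 t1]].
  rewrite /comb big_nil dot0r; apply: cvg_near_cst; apply: nearW => n.
  by rewrite /series /= big1// => i _; rewrite /coef big_nil rmorph0 mulr0 mul0r mulr0.
rewrite [comb (c :: t) x]/comb big_cons dotDr dotZr.
have Hcx := dom_scale c1 Hx.
have -> : series (fun m => (a m)%:C * (coef s m * Num.conj (coef (c :: t) m) *
      ((cnorm x ^+ 2) ^+ m)%:C)) =
  (fun n => Num.conj c.1 * series (fun m => (a m)%:C * (coef s m *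
       cdot (c.2 *: x) x ^+ m)) n +
    series (fun m => (a m)%:C * (coef s m * Num.conj (coef t m) *
      ((cnorm x ^+ 2) ^+ m)%:C)) n).
  apply/funext => n; rewrite /series /= mulr_sumr -big_split.
  apply: eq_bigr => m _; rewrite [coef (c :: t) m]/coef big_cons -/(coef t m).
  have -> : Num.conj (c.1 * Num.conj c.2 ^+ m + coef t m) =
      Num.conj c.1 * c.2 ^+ m + Num.conj (coef t m).
    by rewrite rmorphD rmorphM rmorphXn /= conjCK.
  rewrite rmorphXn /= cdotZl exprMn cdot_self.
  by ring.
apply: cvgD; last exact: IH.
exact: (cvgZr (comb_kernel sD Hx Hcx)).
Qed.

Lemma comb_sqr s x : in_disc s -> dom x ->
  series (fun m => a m * (rn (coef s m) ^+ 2 * (cnorm x ^+ 2) ^+ m)) @ \oo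
    --> rn (comb s x) ^+ 2.
Proof.
move=> sD Hx; have := Re_cvg (comb_dot sD sD Hx); rewrite -rn_sqr.
set u := (u in u @ _); suff -> : u = series (fun m =>
    a m * (rn (coef s m) ^+ 2 * (cnorm x ^+ 2) ^+ m)) by [].
apply/funext => N; rewrite /u /series /=; elim: N => [|N IH]; first by rewrite !big_geq.
by rewrite !big_nat_recr//= Re_add IH mulr_conj -!rmorphM.
Qed.

(** The squared norm of the part of order at least n of the kernel vector at x. *)
Definition tail n x := rn (k x) ^+ 2 - \sum_(0 <= m < n) a m * (cnorm x ^+ 2) ^+ m.

Lemma tail_series n x : dom x ->
  series (fun m => if (m < n)%N then 0 else a m * (cnorm x ^+ 2) ^+ m) @ \oo
    --> tail n x.
Proof.
move=> Hx; have Gs := G_series Hx; rewrite /tail.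
set C := \sum_(_ <= m < _) _.
have c : (fun N => series (fun n => a n * (cnorm x ^+ 2) ^+ n) N - C) @ \oo -->
    rn (k x) ^+ 2 - C by apply: cvgB => //; exact: cvg_cst.
apply: cvg_trans c; apply: near_eq_cvg; exists n => // N /= nN; rewrite /C.
rewrite /series /= (big_cat_nat _ nN)//= addrAC subrr add0r.
rewrite [in RHS](big_cat_nat _ nN)//= [X in _ = X + _]big_nat.
rewrite [X in _ = X + _]big1 ?add0r; last by move=> i /andP[_ ->].
by rewrite !big_nat; apply: eq_bigr => i /andP[ni _]; rewrite ltnNge ni.
Qed.

Lemma tail_cvg0 x (e : R) : dom x -> 0 < e -> exists n, forall m, (n <= m)%N -> tail m x < e.
Proof.
move=> Hx e0; have /cvgrPdist_lt := G_series Hx; move=> /(_ e e0)[N _ hN].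
exists N => n /hN /=; rewrite /tail /series /=.
by apply: le_lt_trans; exact: ler_norm.
Qed.

Lemma comb_le_tail s n x : in_disc s -> dom x ->
  (forall m, (m < n)%N -> coef s m = 0) -> (forall m, rn (coef s m) <= 1) ->
  rn (comb s x) ^+ 2 <= tail n x.
Proof.
move=> sD Hx c0 c1; apply: (series_le (comb_sqr sD Hx) (@tail_series n x Hx)) => m.
case: ifPn => [/c0 ->|_]; first by rewrite rn0 expr0n mul0r mulr0.
rewrite ler_pM2l ?(hardy_gt0 hH)// ler_piMl ?exprn_ge0 ?cnorm_ge0//.
by rewrite expr_le1 ?rn_ge0.
Qed.

(** For m >= n, the terms of degree m at x and at y have a ratio of at most
    (|x|/|y|)^(2n). *)
Lemma tail_le n x y : dom y -> cnorm x <= cnorm y -> 0 < cnorm y ->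
  tail n x <= ((cnorm x / cnorm y) ^+ 2) ^+ n * rn (k y) ^+ 2.
Proof.
move=> Hy xy y0; have Hx := dom_le Hy xy.
apply: (series_le (@tail_series n x Hx) (@series_scale R _ _ (((cnorm x / cnorm y) ^+ 2) ^+ n) (G_series Hy))) => m.
case: ltnP => nm; first by rewrite mulr_ge0 ?G_term_ge0 ?exprn_ge0 ?divr_ge0 ?cnorm_ge0.
rewrite mulrCA ler_pM2l ?(hardy_gt0 hH)//.
set q := cnorm x / cnorm y.
have q0 : 0 <= q by rewrite divr_ge0 ?cnorm_ge0.
have q1 : q <= 1 by rewrite ler_pdivrMr// mul1r.
have -> : cnorm x = q * cnorm y by rewrite /q divfK// gt_eqF.
move: q q0 q1 => q q0 q1; rewrite [(q * _) ^+ 2]exprMn.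
rewrite [leLHS]exprMn ler_wpM2r ?exprn_ge0 ?cnorm_ge0//.
by rewrite -!exprM ler_wiXn2l// leq_mul2l nm orbT.
Qed.

End OneSpace.
End HardyKernel.

(** * Peak functions *)

Section Dilations.
Variable R : realType.
Implicit Types t : R.

(** The weights of the product of the operators 1 - t^-j D for j < n, where D
    maps the point x to t x; it annihilates the Taylor coefficients of degree
    less than n. *)
Fixpoint dil t n : seq (R[i] * R[i]) :=
  if n is j.+1 then
    dil t j ++ [seq (- (t^-1 ^+ j)%:C * c.1, t%:C * c.2) | c <- dil t j]
  else [:: (1, 1)].

Definition wgt t n m : R := \prod_(j < n) (1 - t^-1 ^+ j * t ^+ m).

Lemma coef_dil t n m : coef (dil t n) m = (wgt t n m)%:C.
Proof.
rewrite /wgt; elim: n => [|n IH] /=.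
  by rewrite /coef big_seq1 big_ord0 /= rmorph1 expr1n mul1r.
rewrite big_ord_recr /= /coef big_cat big_map /= -/(coef _ _).
have eX : (t ^+ m)%:C = t%:C ^+ m :> R[i] by exact: rmorphXn.
have -> : \sum_(c <- dil t n) - (t^-1 ^+ n)%:C * c.1 * Num.conj (t%:C * c.2) ^+ m =
    - (t^-1 ^+ n)%:C * (t ^+ m)%:C * coef (dil t n) m.
  rewrite /coef mulr_sumr; apply: eq_bigr => c _.
  by rewrite rmorphM /= conj_real exprMn eX; ring.
by rewrite IH !(rmorphM, rmorphB, rmorph1) /=; ring.
Qed.

Lemma in_disc_dil t n : 0 <= t -> t <= 1 -> in_disc (dil t n).
Proof.
move=> t0 t1; elim: n => [|n IH] /=; first by rewrite /in_disc /= rn1 lexx.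
rewrite /in_disc all_cat; apply/andP; split=> //.
rewrite all_map; apply: sub_all IH => c /= c1.
by rewrite rnM rn_real ger0_norm// mulr_ile1 ?rn_ge0.
Qed.

Lemma wgt_lt t n m : t != 0 -> (m < n)%N -> wgt t n m = 0.
Proof.
move=> t0 mn; rewrite /wgt (bigD1 (Ordinal mn))//= exprVn mulVf ?expf_neq0//.
by rewrite subrr mul0r.
Qed.

Lemma wgt_factor t j m : 0 < t -> t < 1 -> (j < m)%N ->
  1 - t <= 1 - t^-1 ^+ j * t ^+ m <= 1.
Proof.
move=> t0 t1 jm; have -> : t^-1 ^+ j * t ^+ m = t ^+ (m - j).
  by rewrite -{1}(subnKC (ltnW jm)) exprD mulrA -exprMn mulVf ?gt_eqF// expr1n mul1r.
have le0 : 0 <= t ^+ (m - j) by rewrite exprn_ge0 ?ltW.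
have le1 : t ^+ (m - j) <= t.
  by rewrite -[leRHS]expr1 ler_wiXn2l ?subn_gt0 ?(ltW t0) ?(ltW t1).
by apply/andP; split; lra.
Qed.

Lemma wgt_itv t n m : 0 < t -> t < 1 -> 0 <= wgt t n m <= 1.
Proof.
move=> t0 t1; case: (ltnP m n) => [mn|nm].
  by rewrite wgt_lt ?gt_eqF// lexx ler01.
apply/andP; split.
  apply: prodr_ge0 => j _.
  have /andP[h _] := wgt_factor t0 t1 (leq_trans (ltn_ord j) nm).
  by apply: le_trans h; rewrite subr_ge0 ltW.
apply: prodr_ile1 => j _.
have /andP[h ->] := wgt_factor t0 t1 (leq_trans (ltn_ord j) nm).
by rewrite andbT; apply: le_trans h; rewrite subr_ge0 ltW.
Qed.

Lemma wgt_diag t n : 0 < t -> t < 1 -> (1 - t) ^+ n <= wgt t n n.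
Proof.
move=> t0 t1; rewrite /wgt -[n in _ ^+ n](card_ord n) -prodr_const.
apply: ler_prod => j _; rewrite subr_ge0 ltW//=.
by have /andP[h _] := wgt_factor t0 t1 (ltn_ord j).
Qed.

End Dilations.

Section PeakFunctions.
Variables (R : realType) (d : nat) (r : R).
Variables (a : nat -> R) (H : hilbert_function_space R 'rV[R[i]]_d).
Hypothesis hH : hardy r a H.
Local Notation dom := (hfs_dom H).
Local Notation k := (kernel_vec H).
Implicit Types x y q : 'rV[R[i]]_d.

Lemma comb_dilS t j x :
  comb H (dil t j.+1) x =
  comb H (dil t j) x - (t^-1 ^+ j)%:C *: comb H (dil t j) (t%:C *: x).
Proof.
rewrite /comb /= big_cat big_map /=; congr (_ + _).
rewrite scaler_sumr -sumrN; apply: eq_bigr => c _ /=.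
by rewrite mulNr scaleNr !scalerA [t%:C * c.2]mulrC.
Qed.

Variables (t : R) (n : nat) (q : 'rV[R[i]]_d).
Hypotheses (t0 : 0 < t) (t1 : t < 1) (Hq : dom q).

(** A function that vanishes to order n at the origin and is largest at q on
    the ball through q. *)
Definition peak := comb H (dil t n) q.

Let inD : in_disc (dil t n).
Proof. by apply: in_disc_dil; exact: ltW. Qed.

Definition peak_max := complex.Re (hfs_dot H peak (k q)).

Lemma peak_series :
  series (fun m => a m * (wgt t n m * (cnorm q ^+ 2) ^+ m)) @ \oo --> peak_max.
Proof.
have := Re_cvg (comb_kernel hH inD Hq Hq); rewrite -/peak -/peak_max.
set u := (u in u @ _); suff -> : u = series (fun m =>
    a m * (wgt t n m * (cnorm q ^+ 2) ^+ m)) by [].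
apply/funext => N; rewrite /u /series /=; elim: N => [|N IH]; first by rewrite !big_geq.
by rewrite !big_nat_recr//= Re_add IH coef_dil cdot_self -rmorphXn -!rmorphM.
Qed.

Let wgt0 m : 0 <= wgt t n m.
Proof. by have /andP[] := wgt_itv n m t0 t1. Qed.

Lemma peak_norm : rn peak ^+ 2 <= peak_max.
Proof.
apply: (series_le (comb_sqr hH inD Hq) peak_series) => m.
rewrite coef_dil rn_real (ger0_norm (wgt0 m)).
rewrite ler_pM2l ?(hardy_gt0 hH)// ler_wpM2r ?exprn_ge0 ?cnorm_ge0//.
by have /andP[_ w1] := wgt_itv n m t0 t1; rewrite expr2 ler_piMr.
Qed.

Lemma peak_max_ge : a n * ((1 - t) * cnorm q ^+ 2) ^+ n <= peak_max.
Proof.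
apply: (@le_trans _ _ (a n * (wgt t n n * (cnorm q ^+ 2) ^+ n))).
  rewrite ler_pM2l ?(hardy_gt0 hH)// exprMn ler_wpM2r ?exprn_ge0 ?cnorm_ge0//.
  exact: wgt_diag.
apply: (series_ge_term n peak_series) => m.
by rewrite !mulr_ge0 ?exprn_ge0 ?cnorm_ge0// ltW// (hardy_gt0 hH).
Qed.

Lemma peak_le y : q != 0 -> cnorm y <= cnorm q ->
  rn (hfs_dot H peak (k y)) <= (cnorm y / cnorm q) ^+ n * peak_max.
Proof.
move=> q0 yq.
have qp : 0 < cnorm q.
  by rewrite lt_def cnorm_ge0 andbT; apply: contra_neq q0; exact: cnorm_eq0.
have Hy : dom y := dom_le hH Hq yq.
have ps := @series_scale R _ _ ((cnorm y / cnorm q) ^+ n) peak_series.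
apply: (series_rn_le (comb_kernel hH inD Hq Hy) ps) => m.
rewrite rnM rn_real (ger0_norm (ltW (hardy_gt0 hH m))) mulrCA.
rewrite ler_pM2l ?(hardy_gt0 hH)// rnM coef_dil rn_real (ger0_norm (wgt0 m)).
rewrite rnX mulrCA.
case: (ltnP m n) => nm; first by rewrite wgt_lt ?gt_eqF// !mul0r.
apply: ler_wpM2l => //.
apply: (@le_trans _ _ ((cnorm y * cnorm q) ^+ m)).
  by rewrite lerXn2r ?nnegrE ?mulr_ge0 ?rn_ge0 ?cnorm_ge0// cdot_CS.
set s := cnorm y / cnorm q.
have s0 : 0 <= s by rewrite divr_ge0 ?cnorm_ge0.
have s1 : s <= 1 by rewrite ler_pdivrMr// mul1r.
have -> : cnorm y = s * cnorm q by rewrite /s divfK// gt_eqF.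
rewrite -mulrA -expr2 [leLHS]exprMn ler_wpM2r ?exprn_ge0 ?cnorm_ge0//.
by rewrite ler_wiXn2l.
Qed.

End PeakFunctions.

(** Peak functions replace the n-th powers of linear forms in the classical proof
    of the Schwarz lemma; M lies between the value of F at q and the lower bound
    that the term of degree n gives. *)
Lemma peak_exists (R : realType) (d : nat) (r : R) (a : nat -> R)
    (H : hilbert_function_space R 'rV[R[i]]_d) (q : 'rV[R[i]]_d) (t : R) (n : nat) :
  0 < t -> t < 1 -> hardy r a H -> hfs_dom H q -> q != 0 ->
  exists (F : H) (M : R), [/\ 0 < M, M <= rn (hfs_dot H F (kernel_vec H q)),
    rn F ^+ 2 <= M, a n * ((1 - t) * cnorm q ^+ 2) ^+ n <= M &
    forall y, cnorm y <= cnorm q ->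
      rn (hfs_dot H F (kernel_vec H y)) <= (cnorm y / cnorm q) ^+ n * M].
Proof.
move=> t0 t1 hH Hq q0.
have qp : 0 < cnorm q.
  by rewrite lt_def cnorm_ge0 andbT; apply: contra_neq q0; exact: cnorm_eq0.
exists (peak H t n q), (peak_max H t n q); split.
- apply: lt_le_trans (peak_max_ge hH n t0 t1 Hq).
  by rewrite mulr_gt0 ?(hardy_gt0 hH)// exprn_gt0// mulr_gt0 ?subr_gt0// exprn_gt0.
- exact: Re_le_rn.
- exact: (peak_norm hH n t0 t1 Hq).
- exact: (peak_max_ge hH n t0 t1 Hq).
- by move=> y; exact: (peak_le hH n t0 t1 Hq).
Qed.

(** * Unitary maps of the ball *)

Section LinearUnitaries.
Variables (R : realType) (d : nat).
Implicit Types x y q w : 'rV[R[i]]_d.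

(** The map x |-> x - <x,w>/<y,w> w with w = y - q is unitary when y and q have
    the same norm, and sends y to q; exchanging y and q gives its inverse. *)
Definition carry y q x := x - (cdot x (y - q) / cdot y (y - q)) *: (y - q).

Lemma carry_point y q : cdot y (y - q) != 0 -> carry y q y = q.
Proof. by move=> D0; rewrite /carry divff// scale1r subKr. Qed.

Lemma cdot_conj_swap y q : cnorm y = cnorm q ->
  cdot q (q - y) = Num.conj (cdot y (y - q)).
Proof.
move=> e; rewrite !(cdotDr, cdotNr) !cdot_self e rmorphB /= -cdotC.
by rewrite conj_real.
Qed.

Lemma cdot_diff_norm y q : cnorm y = cnorm q ->
  cdot (y - q) (y - q) = cdot y (y - q) + Num.conj (cdot y (y - q)).
Proof.
move=> e; rewrite -cdot_conj_swap// cdotDl cdotNl; congr (_ + _).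
by rewrite -cdotNr opprB.
Qed.

Lemma carryK y q : cnorm y = cnorm q -> cdot y (y - q) != 0 ->
  cancel (carry y q) (carry q y).
Proof.
move=> e D0 x; have C0 : Num.conj (cdot y (y - q)) != 0 by rewrite conjC_eq0.
rewrite /carry (cdot_conj_swap e) -[q - y]opprB.
set w := y - q; set D := cdot y w.
have ww : cdot w w = D + Num.conj D by apply: cdot_diff_norm.
rewrite !cdotNr cdotDl cdotNl cdotZl ww scalerN opprK -addrA -scaleNr -scalerDl.
rewrite [X in X *: _](_ : _ = 0) ?scale0r ?addr0//.
by field; rewrite D0 C0.
Qed.

Lemma carry_cdot y q : cnorm y = cnorm q -> cdot y (y - q) != 0 ->
  forall x x', cdot (carry y q x) (carry y q x') = cdot x x'.
Proof.
move=> e D0 x x'; have C0 : Num.conj (cdot y (y - q)) != 0 by rewrite conjC_eq0.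
rewrite /carry; move: (cdot_diff_norm e) D0 C0.
move: (cdot y (y - q)) (y - q) => D w ww D0 C0.
rewrite !(cdotDl, cdotDr, cdotNl, cdotNr, cdotZl, cdotZr) ww.
rewrite rmorphM fmorphV /= -!(cdotC x').
by field; rewrite D0 C0.
Qed.

Lemma carry_exists y q : cnorm y = cnorm q ->
  exists u v : 'rV[R[i]]_d -> 'rV[R[i]]_d,
  [/\ cancel u v, cancel v u, forall x x', cdot (u x) (u x') = cdot x x' & u y = q].
Proof.
move=> e; have [D0|D0] := eqVneq (cdot y (y - q)) 0.
  have : y - q = 0.
    apply: cnorm_eq0; rewrite /cnorm cdot_diff_norm// D0 rmorph0 addr0 /=.
    by rewrite sqrtr0.
  by move=> /eqP; rewrite subr_eq0 => /eqP ->; exists id, id; split.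
exists (carry y q), (carry q y); split.
- exact: carryK.
- by apply: carryK => //; rewrite cdot_conj_swap// conjC_eq0.
- exact: carry_cdot.
- exact: carry_point.
Qed.

End LinearUnitaries.

Section HardyUnitaries.
Variables (R : realType) (d : nat) (r : R).
Variables (a : nat -> R) (H : hilbert_function_space R 'rV[R[i]]_d).
Hypothesis hH : hardy r a H.

Lemma kernel_cdot x y x' y' : hfs_dom H x -> hfs_dom H y -> hfs_dom H x' ->
  hfs_dom H y' -> cdot y x = cdot y' x' ->
  hfs_dot H (kernel_vec H x) (kernel_vec H y) =
  hfs_dot H (kernel_vec H x') (kernel_vec H y').
Proof.
move=> Hx Hy Hx' Hy' e.
have := hardy_ker hH Hy Hx; rewrite e => c1.
exact: (cvg_unique (@norm_hausdorff _ _) c1 (hardy_ker hH Hy' Hx')).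
Qed.

Lemma hardy_unitary u v : cancel u v -> cancel v u ->
  (forall x x', cdot (u x) (u x') = cdot x x') ->
  exists T S, @rk_pair R _ H H 1 1 u v T S (fun=> 1) (fun=> 1).
Proof.
move=> uK vK eu.
have ev x x' : cdot (v x) (v x') = cdot x x' by rewrite -eu !vK.
have nu x : cnorm (u x) = cnorm x by rewrite /cnorm eu.
have nv x : cnorm (v x) = cnorm x by rewrite /cnorm ev.
have uD x : hfs_dom H x -> hfs_dom H (u x).
  by move=> Hx; apply: (dom_le hH Hx); rewrite nu.
have vD x : hfs_dom H x -> hfs_dom H (v x).
  by move=> Hx; apply: (dom_le hH Hx); rewrite nv.
apply: kernel_unitary => // x y Hx Hy; apply: kernel_cdot => //; exact: uD.
Qed.

End HardyUnitaries.

(** * Circles in the domain *)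

Section Circle.
Variable R : realType.
Implicit Types th : R.

Definition cis th : R[i] := Complex (cos th) (sin th).

Lemma cis0 : cis 0 = 1.
Proof. by rewrite /cis cos0 sin0. Qed.

Lemma cisD x y : cis (x + y) = cis x * cis y.
Proof. by rewrite /cis cosD sinD; congr Complex; rewrite addrC. Qed.

Lemma cispi : cis pi = -1.
Proof. by rewrite /cis cospi sinpi; apply/eqP; rewrite eq_complex /= oppr0 !eqxx. Qed.

Lemma rn_cis th : rn (cis th) = 1.
Proof. by rewrite /rn normc_def /= cos2Dsin2 sqrtr1. Qed.

Lemma cis_root j : cis (pi / 2 ^+ j) ^+ (2 ^ j) = -1.
Proof.
elim: j => [|j IH]; first by rewrite expr0 divr1 expr1 cispi.
rewrite expnS exprM expr2 -cisD -IH; congr (cis _ ^+ _).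
by rewrite exprS; field; rewrite expf_neq0.
Qed.

Lemma rn_Re_Im (z : R[i]) : rn z <= `|complex.Re z| + `|complex.Im z|.
Proof.
case: z => x y /=; rewrite [Complex x y](_ : _ = x%:C + 'i * y%:C).
  apply: le_trans (rnD _ _) _; rewrite rnM !rn_real.
  by rewrite [rn 'i](_ : _ = 1) ?mul1r// /rn normc_def /= expr0n expr1n add0r sqrtr1.
by apply/eqP; rewrite eq_complex /= !(mul0r, mulr0, mul1r, subr0, addr0, add0r) !eqxx.
Qed.

Lemma cis_continuous th (e : R) : 0 < e -> \forall x \near th, rn (cis th - cis x) < e.
Proof.
move=> e0; have e2 := half_gt0 e0.
have /cvgrPdist_lt /(_ _ e2) c := @continuous_cos R th.
have /cvgrPdist_lt /(_ _ e2) s := @continuous_sin R th.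
near=> x; apply: le_lt_trans (rn_Re_Im _) _ => /=.
rewrite [ltRHS]splitr; apply: ltrD.
  by near: x; exact: c.
by near: x; exact: s.
Unshelve. all: end_near. Qed.

(** Weights for the average over the 2^j vertices of the regular polygon with a
    vertex at cis th. Doubling the number of vertices by one rotation avoids sums
    over roots of unity. *)
Fixpoint rots j th : seq (R[i] * R[i]) :=
  if j is j'.+1 then
    [seq ((2^-1)%:C * c.1, c.2) | c <- rots j' th ++ rots j' (th + pi / 2 ^+ j')]
  else [:: (1, cis th)].

Lemma in_disc_rots j th : in_disc (rots j th).
Proof.
elim: j th => [|j IH] th /=; first by rewrite /in_disc /= rn_cis lexx.
by rewrite /in_disc all_map all_cat; apply/andP; split; exact: IH.
Qed.

Lemma coef_rots j th m : coef (rots j th) m =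
  if (2 ^ j %| m)%N then Num.conj (cis th) ^+ m else 0.
Proof.
elim: j th => [|j IH] th /=; first by rewrite dvd1n /coef big_seq1 /= mul1r.
have -> : coef [seq ((2^-1)%:C * c.1, c.2) |
      c <- rots j th ++ rots j (th + pi / 2 ^+ j)] m =
    (2^-1)%:C * (coef (rots j th) m + coef (rots j (th + pi / 2 ^+ j)) m).
  rewrite /coef big_map -big_cat mulr_sumr /=.
  by apply: eq_bigr => c _; rewrite mulrA.
rewrite !IH; case: ifPn => [/dvdnP[l ->]|nd]; last first.
  rewrite addr0 mulr0 ifF//; apply/negbTE; apply: contra nd.
  by apply: dvdn_trans; rewrite expnS dvdn_mull.
rewrite expnS dvdn_pmul2r ?expn_gt0// cisD rmorphM exprMn.
have -> : Num.conj (cis (pi / 2 ^+ j)) ^+ (l * 2 ^ j) = (-1) ^+ l.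
  by rewrite mulnC exprM -rmorphXn cis_root rmorphN1.
rewrite dvdn2 -signr_odd; case: (odd l) => /=.
  by rewrite expr1 mulrN1 subrr mulr0.
have h : (2^-1)%:C + (2^-1)%:C = 1 :> R[i].
  by rewrite -rmorphD /= -[2^-1]mul1r -splitr.
by rewrite expr0 mulr1 mulrDr -mulrDl h mul1r.
Qed.

End Circle.

Section CircleOrbit.
Variables (R : realType) (d : nat) (r : R).
Variables (b : nat -> R) (K : hilbert_function_space R 'rV[R[i]]_d).
Hypothesis hK : hardy r b K.
Variable p : 'rV[R[i]]_d.
Hypothesis Kp : hfs_dom K p.
Local Notation k := (kernel_vec K).
Local Notation orb th := (cis th *: p).

Lemma orb_norm th : cnorm (orb th) = cnorm p.
Proof. by rewrite cnormZ rn_cis mul1r. Qed.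

Lemma orb_dom th : hfs_dom K (orb th).
Proof. by apply: (dom_le hK Kp); rewrite orb_norm. Qed.

Lemma orb_kernel_norm th : rn (k (orb th)) = rn (k p).
Proof.
apply: (@pexpIrn _ 2); rewrite ?nnegrE ?rn_ge0//.
apply/eqP; rewrite eq_le.
by rewrite !(G_le hK) ?orb_norm//; exact: orb_dom.
Qed.

(** Weak continuity of the kernel vectors is the continuity of the functions of
    the space; on a circle the norm is constant, so that it becomes continuity
    in norm. *)
Lemma orb_continuous th (e : R) : 0 < e ->
  \forall x \near th, rn (k (orb th) - k (orb x)) < e.
Proof.
move=> e0; have K1 := orb_dom th.
have cont : orb x @[x --> th] --> orb th.
  apply: cvgZr_tmp; apply/cvgrPdist_lt => eps eps0.
  have eps0' : 0 < complex.Re eps by move: eps0; rewrite ltcE => /andP[].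
  have := cis_continuous th eps0'; apply: filterS => x /= h.
  by rewrite rnE -[eps](@RRe_real R) ?gtr0_real// ltcR.
have /subspace_continuousP /(_ _ K1) := @hardy_cont _ _ _ _ _ hK (k (orb th)).
move=> /cvgrPdist_lt /(_ (e ^+ 2 / 2)%:C).
rewrite ltcR divr_gt0 ?exprn_gt0// => /(_ isT) ev.
have ev' : \forall x \near th, hfs_dom K (orb x) ->
    `|hfs_ev (k (orb th)) (orb th) - hfs_ev (k (orb th)) (orb x)| < (e ^+ 2 / 2)%:C.
  exact: cont _ ev.
apply: filterS ev' => x /(_ (orb_dom x)); rewrite rnE ltcR => h.
rewrite !kernel_vecP// in h; last exact: orb_dom.
move: h (orb_kernel_norm th) (orb_kernel_norm x).
move: (k (orb th)) (k (orb x)) => u v h nu nv.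
rewrite -(@ltr_pXn2r _ 2%N) ?nnegrE ?rn_ge0 ?ltW// rnB_sqr nv.
move: h; rewrite dot_self => /(le_lt_trans (Re_le_rn _)).
by rewrite Re_sub /= nu; lra.
Qed.

End CircleOrbit.

(** * Reduction to isomorphisms that fix the origin *)

Local Opaque rn cnorm kernel_vec cis.

Lemma geometric_small (R : realType) (C q e : R) :
  0 <= q -> q < 1 -> 0 < e -> exists n, C * q ^+ n < e.
Proof.
move=> q0 q1 e0.
have : C * q ^+ n @[n --> \oo] --> C * 0.
  by apply: cvgMr; apply: cvg_expr; rewrite ger0_norm.
rewrite mulr0 => /cvgrPdist_lt /(_ e e0)[n _ /(_ n (leqnn n))] /=.
by rewrite sub0r normrN => h; exists n; apply: le_lt_trans h; exact: ler_norm.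
Qed.

Lemma continuous_ratio_sqr (R : realType) (f g h : R -> R) :
  continuous f -> continuous g -> (forall x, g x != 0) ->
  (forall x, h x = (f x / g x) ^+ 2) -> continuous h.
Proof.
move=> cf cg g0 hE.
have -> : h = (fun x => (f x / g x) * (f x / g x)) by apply/funext => x; rewrite hE expr2.
have cfg : continuous (fun x => f x / g x).
  by move=> x; apply: cvgM; [exact: cf | apply: cvgV; [exact: g0 | exact: cg]].
by move=> x; apply: cvgM; exact: cfg.
Qed.

Section MeanValue.
Variables (R : realType) (d : nat) (r : R).
Variables (b : nat -> R) (K : hilbert_function_space R 'rV[R[i]]_d).
Hypothesis hK : hardy r b K.
Variable p : 'rV[R[i]]_d.
Hypothesis Kp : hfs_dom K p.
Local Notation k := (kernel_vec K).

Lemma rots_bound (l : K -> R[i]) (C : R) :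
  (forall c f g, l (c *: f + g) = c * l f + l g) ->
  (forall th, 0 <= th <= 2 * pi -> rn (l (k (cis th *: p))) <= C) ->
  forall j, rn (l (comb K (rots j 0) p)) <= C.
Proof.
move=> lD lC j.
have pi0 : 0 < pi :> R := pi_gt0 R.
suff : forall th, 0 <= th <= 2 * (pi / 2 ^+ j) -> rn (l (comb K (rots j th) p)) <= C.
  by apply; rewrite lexx /= mulr_ge0// divr_ge0 ?exprn_ge0// ltW.
elim: j => [|j IH] th.
  by rewrite expr0 divr1 => /lC; rewrite /comb big_seq1 scale1r.
move=> /andP[th0 th1].
have e1 : pi / 2 ^+ j = 2 * (pi / 2 ^+ j.+1) :> R.
  by rewrite exprS; field; rewrite expf_neq0.
have q0 : 0 <= pi / 2 ^+ j.+1 :> R by rewrite divr_ge0 ?exprn_ge0// ltW.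
have lZ := @scaleP _ K (R[i]^o) l lD.
have l0 : l 0 = 0 by rewrite -(scale0r 0) lZ scale0r.
have -> : comb K (rots j.+1 th) p = (2^-1)%:C *: comb K (rots j th) p +
    (2^-1)%:C *: comb K (rots j (th + pi / 2 ^+ j)) p.
  rewrite /comb /= big_map big_cat /= !scaler_sumr.
  by congr (_ + _); apply: eq_bigr => c _; rewrite scalerA.
rewrite lD lZ; apply: le_trans (rnD _ _) _.
rewrite rnM [rn (_ *: _)]rnM rn_real ger0_norm ?invr_ge0//.
have h1 := IH th; have h2 := IH (th + pi / 2 ^+ j).
move: h1 h2; rewrite !e1; set q := pi / _ in q0 th1 *; move=> h1 h2.
have {}h1 := h1 ltac:(apply/andP; split; lra).
have {}h2 := h2 ltac:(apply/andP; split; lra).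
lra.
Qed.

(** The averages over the vertices of regular polygons tend to the kernel vector
    at the centre, because they only retain the Taylor coefficients of degree
    divisible by 2^j. *)
Lemma rots_cvg (e : R) : 0 < e -> exists j, rn (comb K (rots j 0) p - k 0) < e.
Proof.
move=> e0; have [n hn] := tail_cvg0 hK Kp (exprn_gt0 2 e0).
exists n; pose s := rots n 0 ++ [:: (-1, 0 : R[i])].
have -> : comb K (rots n 0) p - k 0 = comb K s p.
  by rewrite /comb big_cat big_seq1 /= scale0r scaleN1r.
rewrite -(@ltr_pXn2r _ 2%N) ?nnegrE ?rn_ge0 ?ltW//.
have cE m : coef s m = (2 ^ n %| m)%:R - (m == 0)%:R.
  rewrite /coef big_cat big_seq1 /= -/(coef _ _) coef_rots cis0 rmorph1 expr1n.
  rewrite rmorph0 expr0n mulN1r; congr (_ - _).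
  by case: (2 ^ n %| m)%N.
apply: le_lt_trans (comb_le_tail (n := 2 ^ n) hK _ Kp _ _) (hn _ _).
- by rewrite /in_disc all_cat; apply/andP; split; [exact: in_disc_rots|rewrite /= rn0 ler01].
- case=> [|m] mn; first by rewrite cE dvdn0 subrr.
  by rewrite cE gtnNdvd// subr0.
- move=> m; rewrite cE; case: m => [|m]; first by rewrite dvdn0 subrr rn0 ler01.
  by rewrite subr0; case: (_ %| _)%N; rewrite ?rn1 ?rn0 ?ler01.
- exact: ltnW (ltn_expl _ _).
Qed.

End MeanValue.

Section FixOrigin.
Variables (R : realType) (d : nat) (r : R).
Hypothesis r0 : 0 < r.
Variables (a b : nat -> R) (H K : hilbert_function_space R 'rV[R[i]]_d).
Hypotheses (hH : hardy r a H) (hK : hardy r b K).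
Variables (A B : R) (phi psi : 'rV[R[i]]_d -> 'rV[R[i]]_d) (T : H -> K) (S : K -> H).
Variables (lam mu : 'rV[R[i]]_d -> R[i]).
Hypothesis p : @rk_pair R _ H K A B phi psi T S lam mu.
Local Notation p0 := (phi 0).
Local Notation q0 := (psi 0).
Local Notation orb th := (cis th *: p0).
Local Notation y th := (psi (orb th)).
Local Notation kH := (kernel_vec H).
Local Notation kK := (kernel_vec K).

Let H0 : hfs_dom H 0. Proof. exact: (dom0 r0 hH). Qed.
Let K0 : hfs_dom K 0. Proof. exact: (dom0 r0 hK). Qed.
Let Kp : hfs_dom K p0. Proof. exact: (rp_phi p H0). Qed.
Let Hq : hfs_dom H q0. Proof. exact: (rp_psi p K0). Qed.
Let Korb th : hfs_dom K (orb th). Proof. exact: (orb_dom hK Kp th). Qed.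
Let Hy th : hfs_dom H (y th). Proof. exact: (rp_psi p (Korb th)). Qed.

(** By continuity of S k along the circle: S k at z is conj (mu z) times the kernel
    vector at psi z, and its inner product with k_0 recovers the factor conj (mu z). *)
Lemma orbit_kernel_continuous : continuous (fun th => rn (kH (y th)) ^+ 2).
Proof.
have B0 := rp_B0 p.
have lip (f : R -> R) (C : R) : 0 <= C ->
    (forall s t, `|f s - f t| <= C * rn (kK (orb s) - kK (orb t))) -> continuous f.
  move=> C0 fC th; apply/cvgrPdist_lt => e e0.
  have C1 : 0 < 1 + C by rewrite ltr_pwDl.
  have := orb_continuous hK Kp th (divr_gt0 e0 C1); apply: filterS => x h.
  apply: le_lt_trans (fC th x) _.
  move: h; rewrite ltr_pdivlMr//; set z := rn _ => h.
  by have : 0 <= z := rn_ge0 _; lra.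
have SB u v : S (u - v) = S u - S v.
  have := rp_linS p (-1) v u; rewrite !scaleN1r addrC => ->.
  by rewrite addrC.
have c1 : continuous (fun th => rn (S (kK (orb th)))).
  apply: (lip _ B) => // s t; apply: le_trans (ler_rn_dist _ _) _.
  by rewrite -SB (rp_bS p).
have c2 : continuous (fun th => rn (hfs_dot H (S (kK (orb th))) (kH 0))).
  apply: (lip _ B) => // s t; apply: le_trans (ler_rn_dist _ _) _.
  rewrite -dotBl -SB; apply: le_trans (dot_CS _ _) _.
  by rewrite (rn_k0 r0 hH) mulr1 (rp_bS p).
have mu0 th : rn (Num.conj (mu (orb th))) != 0.
  by rewrite rn_conj rn_eq0 (rp_mu p (Korb th)).
have e1 th : rn (kH (y th)) ^+ 2 =
    (rn (S (kK (orb th))) / rn (hfs_dot H (S (kK (orb th))) (kH 0))) ^+ 2.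
  rewrite (rp_kS p (Korb th)) rnZ dotZl rnM dotC (dot_k0 r0 hH (Hy th)) rmorph1 rn1 mulr1.
  by rewrite mulrC mulKf// mu0.
have D0 th : rn (hfs_dot H (S (kK (orb th))) (kH 0)) != 0.
  rewrite (rp_kS p (Korb th)) dotZl rnM dotC (dot_k0 r0 hH (Hy th)) rmorph1 rn1 mulr1.
  exact: mu0.
exact: continuous_ratio_sqr c1 c2 D0 e1.
Qed.

(** A maximum principle. For a peak function F of order n at q0, the value of
    mu (F o psi) at 0 is the mean of its values on the circle through p0, where
    F o psi is at most (rho/|q0|)^n times its value at 0. *)
Lemma orbit_bound (rho : R) n : q0 != 0 -> rho <= cnorm q0 ->
  (forall th, 0 <= th <= 2 * pi -> cnorm (y th) <= rho) ->
  rn (mu 0) <= B * rn (kK p0) * (rho / cnorm q0) ^+ n.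
Proof.
move=> qn0 rq yr; have half0 : 0 < 2^-1 :> R by rewrite invr_gt0.
have half1 : 2^-1 < 1 :> R by rewrite invf_lt1// ltr1n.
have [F [M [M0 FM _ _ Fy]]] := peak_exists n half0 half1 hH Hq qn0.
pose l g := hfs_dot H (S g) F.
have lD e f g : l (e *: f + g) = e * l f + l g.
  by rewrite /l (rp_linS p) dotDl dotZl.
have B0 := rp_B0 p.
have lB g : rn (l g) <= B * rn g * rn F.
  by apply: le_trans (dot_CS _ _) _; rewrite ler_wpM2r ?rn_ge0// (rp_bS p).
have mu_le th : rn (mu (orb th)) <= B * rn (kK p0).
  have := rp_bS p (kK (orb th)).
  rewrite (orb_kernel_norm hK Kp th) (rp_kS p (Korb th)) rnZ rn_conj.
  apply: le_trans; rewrite ler_peMr ?rn_ge0//.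
  by rewrite -(@ler_pXn2r _ 2) ?nnegrE ?rn_ge0// expr1n (G_ge1 r0 hH (Hy th)).
have ge0q : 0 <= (cnorm q0)^-1 by rewrite invr_ge0 cnorm_ge0.
have lE z : hfs_dom K z -> rn (l (kK z)) = rn (mu z) * rn (hfs_dot H F (kH (psi z))).
  by move=> Kz; rewrite /l (rp_kS p Kz) dotZl rnM rn_conj dotC rn_conj.
set ka := rho / _.
have lC th : 0 <= th <= 2 * pi -> rn (l (kK (orb th))) <= B * rn (kK p0) * (ka ^+ n * M).
  move=> thI; have yth := yr th thI; rewrite (lE _ (Korb th)).
  apply: ler_pM; [exact: rn_ge0|exact: rn_ge0|exact: mu_le|].
  apply: le_trans (Fy _ (le_trans yth rq)) _.
  apply: ler_wpM2r; first exact: ltW.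
  have cy := cnorm_ge0 (y th).
  have h1 : 0 <= cnorm (y th) / cnorm q0 by exact: mulr_ge0.
  have h2 : cnorm (y th) / cnorm q0 <= ka by exact: ler_wpM2r.
  by apply: lerXn2r => //; rewrite nnegrE //; exact: le_trans h2.
suff lk0 : rn (l (kK 0)) <= B * rn (kK p0) * (ka ^+ n * M).
  have : rn (mu 0) * M <= B * rn (kK p0) * ka ^+ n * M.
    rewrite -[leRHS]mulrA; apply: le_trans lk0; rewrite (lE _ K0).
    by apply: ler_wpM2l => //; exact: rn_ge0.
  by rewrite ler_pM2r.
move: (B * rn (kK p0) * _) lC => C lC.
apply/ler_addgt0Pr => e e0.
have f0 : 0 <= rn F := rn_ge0 F.
have D0 : 0 < 1 + B * rn F by apply: ltr_pwDl => //; exact: mulr_ge0.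
have [j hj] := rots_cvg hK Kp (divr_gt0 e0 D0).
have hC := rots_bound lD lC j.
move: (comb _ _ _) hj hC => m hj hC.
have -> : l (kK 0) = l m - l (m - kK 0).
  by have := lD (-1) (m - kK 0) m; rewrite scaleN1r mulN1r opprB subrK addrC => ->.
apply: le_trans (rnB _ _) _; apply: lerD => //.
apply: le_trans (lB _) _.
move: hj; rewrite ltr_pdivlMr// => hj; apply: le_trans (ltW hj).
rewrite mulrAC [leRHS]mulrC.
by apply: ler_wpM2r; [exact: rn_ge0 | rewrite lerDr].
Qed.

(** On the circle through p0 = phi 0, the norm of psi vanishes at p0 itself. By the
    intermediate value theorem, the claim can only fail if psi maps the circle into
    a ball strictly inside the one through q0. As n grows, the maximum principle of
    orbit_bound then forces mu 0 = 0. *)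
Lemma orbit_reaches : exists th, cnorm (y th) = cnorm q0.
Proof.
have [q00|qn0] := eqVneq q0 0.
  exists 0; rewrite cis0 scale1r (rp_phiK p H0) q00; exact: erefl.
have qp : 0 < cnorm q0.
  by rewrite lt_def cnorm_ge0 andbT; apply: contra_neq qn0; exact: cnorm_eq0.
have [h hE hc] : exists2 h : R -> R, forall th, rn (kH (y th)) ^+ 2 = h th & continuous h.
  by exists (fun th => rn (kH (y th)) ^+ 2) => //; exact: orbit_kernel_continuous.
have hw u v : {within `[u, v]%classic, continuous h} by apply: continuous_subspaceT.
have pi0 : 0 <= 2 * pi :> R by rewrite mulr_ge0// ltW// pi_gt0.
have [c /itvP cI cmax] := EVT_max pi0 (hw 0 (2 * pi)).
have h0 : h 0 = 1.
  by rewrite -hE cis0 scale1r (rp_phiK p H0) (rn_k0 r0 hH) expr1n.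
have Gq1 := G_ge1 r0 hH Hq.
have [le1|lt1] := leP (rn (kH q0) ^+ 2) (h c).
  have c0 : 0 <= c by rewrite cI.
  have [|th _ hth] := @IVT R h 0 c (rn (kH q0) ^+ 2) c0 (hw 0 c).
    by rewrite ge_min le_max le1 orbT andbT h0 Gq1.
  by exists th; apply: (G_inj hH (Hy th) Hq); rewrite hE.
rewrite -hE in lt1; have ltq := G_lt hH (Hy c) Hq lt1.
have yc th : 0 <= th <= 2 * pi -> cnorm (y th) <= cnorm (y c).
  move=> thI; rewrite leNgt; apply/negP => lt2.
  have h1 : h th <= h c by apply: cmax; rewrite in_itv.
  have h2 : a 1%N * (cnorm (y th) ^+ 2 - cnorm (y c) ^+ 2) <= h th - h c.
    by rewrite -(hE th) -(hE c); exact: (G_sub hH (Hy c) (Hy th) (ltW lt2)).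
  have : 0 < a 1%N * (cnorm (y th) ^+ 2 - cnorm (y c) ^+ 2).
    by rewrite mulr_gt0 ?(hardy_gt0 hH)// subr_gt0 ltr_pXn2r ?nnegrE ?cnorm_ge0.
  by move=> /lt_le_trans/(_ h2); rewrite subr_gt0 ltNge h1.
have mup : 0 < rn (mu 0) by rewrite lt_def rn_eq0 (rp_mu p K0) rn_ge0.
exfalso; have ka0 : 0 <= cnorm (y c) / cnorm q0 by apply: divr_ge0; exact: cnorm_ge0.
have ka1 : cnorm (y c) / cnorm q0 < 1 by rewrite ltr_pdivrMr// mul1r.
have [n hn] := geometric_small (B * rn (kK p0)) ka0 ka1 mup.
have := orbit_bound n qn0 (ltW ltq) yc.
by rewrite leNgt hn.
Qed.

End FixOrigin.

(** If y th, the image under psi of a point of the circle through phi 0, has the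
    norm of psi 0, then inserting a rotation of that circle and a unitary map
    from y th to psi 0 into phi o psi o phi gives a map that fixes the origin. *)
Lemma fix_origin (R : realType) (d : nat) (r : R) (a b : nat -> R)
    (H K : hilbert_function_space R 'rV[R[i]]_d) (A B : R) : 0 < r ->
  hardy r a H -> hardy r b K -> related H K A B ->
  exists A' B' phi psi T S lam mu,
    [/\ @rk_pair R _ H K A' B' phi psi T S lam mu, phi 0 = 0 & A' * B' = (A * B) ^+ 3].
Proof.
move=> r0 hH hK [phi [psi [T [S [lam [mu p]]]]]].
have [th yq] := orbit_reaches r0 hH hK p.
have [u [v [uK vK eu uy]]] := carry_exists yq.
have [TV [SV pV]] := hardy_unitary hH uK vK eu.
have rotK s : cancel (fun z : 'rV[R[i]]_d => cis s *: z) (fun z => cis (- s) *: z).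
  by move=> z; rewrite scalerA -cisD addNr cis0 scale1r.
have rotK' : cancel (fun z : 'rV[R[i]]_d => cis (- th) *: z) (fun z => cis th *: z).
  by have := rotK (- th); rewrite opprK.
have erot (z w : 'rV[R[i]]_d) : cdot (cis th *: z) (cis th *: w) = cdot z w.
  by rewrite cdotZl cdotZr mulrA mulr_conj rn_cis expr1n mul1r.
have [TU [SU pU]] := hardy_unitary hK (rotK th) rotK' erot.
have p4 := rk_pair_comp (rk_pair_comp (rk_pair_comp (rk_pair_comp p pU)
  (rk_pair_sym p)) pV) p.
do 8 eexists; split; first exact: p4.
  by rewrite /= uy (rp_psiK p (dom0 r0 hK)).
by ring.
Qed.

(** * The Schwarz lemma *)

Section SchwarzLemma.
Variables (R : realType) (d : nat) (r : R).
Hypothesis r0 : 0 < r.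
Variables (a b : nat -> R) (H K : hilbert_function_space R 'rV[R[i]]_d).
Hypotheses (hH : hardy r a H) (hK : hardy r b K).
Variables (A B : R) (phi psi : 'rV[R[i]]_d -> 'rV[R[i]]_d) (T : H -> K) (S : K -> H).
Variables (lam mu : 'rV[R[i]]_d -> R[i]).
Hypothesis p : @rk_pair R _ H K A B phi psi T S lam mu.
Hypothesis phi0 : phi 0 = 0.
Local Notation kH := (kernel_vec H).
Local Notation kK := (kernel_vec K).

Let H0 : hfs_dom H 0. Proof. exact: (dom0 r0 hH). Qed.
Let K0 : hfs_dom K 0. Proof. exact: (dom0 r0 hK). Qed.

(** The quantity 1 - 1/|k_x|^2 is the squared sine of the angle between k_x and
    the constant function k_0. As T maps the lines of k_x and k_0 to those of
    k_(phi x) and k_0, it distorts this quantity by at most (A B)^2. *)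
Lemma angle_distortion x : hfs_dom H x ->
  (rn (kK (phi x)) ^+ 2 - 1) * rn (kH x) ^+ 2 <=
  (A * B) ^+ 2 * (rn (kH x) ^+ 2 - 1) * rn (kK (phi x)) ^+ 2.
Proof.
move=> Hx; have Kx := rp_phi p Hx; set y := phi x in Kx *.
have nH : rn (kH x - kH 0) ^+ 2 = rn (kH x) ^+ 2 - 1.
  rewrite rnB_sqr dotC (dot_k0 r0 hH Hx) rmorph1 /= (rn_k0 r0 hH) expr1n; lra.
have nK : rn (kK y - kK 0) ^+ 2 = rn (kK y) ^+ 2 - 1.
  rewrite rnB_sqr dotC (dot_k0 r0 hK Kx) rmorph1 /= (rn_k0 r0 hK) expr1n; lra.
have TB u v : T (u - v) = T u - T v.
  have := rp_linT p (-1) v u; rewrite !scaleN1r addrC => ->.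
  by rewrite addrC.
have low : rn (lam x) ^+ 2 * (rn (kK y) ^+ 2 - 1) <= rn (T (kH x - kH 0)) ^+ 2.
  rewrite TB (rp_kT p Hx) (rp_kT p H0) phi0 -/y.
  set al := Num.conj (lam x); set be := Num.conj (lam 0).
  have -> : al *: kK y - be *: kK 0 = al *: (kK y - kK 0) + (al - be) *: kK 0.
    by rewrite scalerBr scalerBl addrA subrK.
  rewrite rnD_sqr rnZ exprMn nK rn_conj dotZl dotZr dotBl.
  rewrite (dotC (kK 0) (kK y)) (dot_k0 r0 hK Kx) (dot_k0 r0 hK K0) rmorph1 subrr.
  by rewrite !mulr0 /= ?mulr0 addr0 lerDl sqr_ge0.
have up : rn (T (kH x - kH 0)) ^+ 2 <= A ^+ 2 * (rn (kH x) ^+ 2 - 1).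
  rewrite -nH -exprMn lerXn2r ?nnegrE ?mulr_ge0 ?rn_ge0 ?(rp_A0 p)//.
  exact: (rp_bT p).
have back : rn (kH x) ^+ 2 <= B ^+ 2 * (rn (lam x) ^+ 2 * rn (kK y) ^+ 2).
  rewrite -!exprMn lerXn2r ?nnegrE ?mulr_ge0 ?rn_ge0 ?(rp_B0 p)//.
  rewrite -rn_conj -rnZ -(rp_kT p Hx) -{1}(rp_TK p (kH x)).
  exact: (rp_bS p).
have g2 : 0 <= rn (kK y) ^+ 2 - 1 by rewrite subr_ge0 (G_ge1 r0 hK Kx).
have g20 : 0 <= rn (kK y) ^+ 2 := sqr_ge0 _.
have B20 : 0 <= B ^+ 2 := sqr_ge0 _.
move: (rn (lam x) ^+ 2) (rn (kK y) ^+ 2) (rn (kH x) ^+ 2) low up back g2 g20.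
move=> L G2 G1 low up back g2 g20.
have h1 := le_trans low up.
apply: le_trans (ler_wpM2l g2 back) _.
rewrite exprMn.
have -> : (G2 - 1) * (B ^+ 2 * (L * G2)) = B ^+ 2 * G2 * (L * (G2 - 1)) by ring.
have -> : A ^+ 2 * B ^+ 2 * (G1 - 1) * G2 = B ^+ 2 * G2 * (A ^+ 2 * (G1 - 1)) by ring.
by apply: ler_wpM2l => //; exact: mulr_ge0.
Qed.

Lemma lam_le x : hfs_dom H x -> rn (lam x) <= A * rn (kH x).
Proof.
move=> Hx; apply: le_trans (rp_bT p _); rewrite (rp_kT p Hx) rnZ rn_conj.
rewrite ler_peMr ?rn_ge0// -(@ler_pXn2r _ 2) ?nnegrE ?rn_ge0// expr1n.
exact: (G_ge1 r0 hK (rp_phi p Hx)).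
Qed.

Lemma rn_scale_le1 (s : R) : 0 < s <= 1 -> rn s%:C <= 1.
Proof. by move=> /andP[s0 s1]; rewrite rn_real ger0_norm// ltW. Qed.

Lemma G_scale x (s : R) : hfs_dom H x -> 0 < s <= 1 ->
  rn (kH (s%:C *: x)) ^+ 2 - 1 <= s ^+ 2 * (rn (kH x) ^+ 2 - 1).
Proof.
move=> Hx s01; have /andP[s0 s1] := s01.
have Hs := dom_scale hH (rn_scale_le1 s01) Hx.
have t1 := @tail_series _ _ _ _ _ hH 1 _ Hs.
have t2 := @series_scale R _ _ (s ^+ 2) (@tail_series _ _ _ _ _ hH 1 _ Hx).
have tE z : tail a H 1 z = rn (kH z) ^+ 2 - 1.
  by rewrite /tail big_nat1 expr0 mulr1 (hardy0 hH).
rewrite -!tE; apply: (series_le t1 t2) => m.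
case: m => [|m] /=; first by rewrite mulr0.
rewrite cnormZ rn_real (ger0_norm (ltW s0)) mulrCA ler_pM2l ?(hardy_gt0 hH)//.
rewrite [(s * _) ^+ 2]exprMn [leLHS]exprMn ler_wpM2r ?exprn_ge0 ?cnorm_ge0//.
rewrite -[leRHS]expr1 ler_wiXn2l ?sqr_ge0//.
by rewrite expr_le1// ltW.
Qed.

(** By the distortion of angles, |phi (s x)| = O(s), and F vanishes to order n at
    the origin. For those s at which phi (s x) lies outside of the ball through q,
    the bound on F is not available, but such s stay away from 0. *)
Lemma order_bound x q (F : K) (M : R) n : hfs_dom H x -> hfs_dom K q ->
  0 < cnorm q -> 0 <= M ->
  (forall y, cnorm y <= cnorm q ->
    rn (hfs_dot K F (kK y)) <= (cnorm y / cnorm q) ^+ n * M) ->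
  exists2 C, 0 <= C & forall s : R, 0 < s <= 1 ->
    rn (hfs_dot K (T (kH (s%:C *: x))) F) <= C * s ^+ n.
Proof.
move=> Hx Kq q0 M0 Fy.
have A0 := rp_A0 p.
have [Gx [Gx1 GxE]] : exists Gx, 1 <= Gx /\ rn (kH x) ^+ 2 = Gx.
  by exists (rn (kH x) ^+ 2); split=> //; exact: (G_ge1 r0 hH Hx).
have [Gq [Gq1 GqE]] : exists Gq, 1 < Gq /\ rn (kK q) ^+ 2 = Gq.
  exists (rn (kK q) ^+ 2); split=> //.
  have := G_sub hK K0 Kq; rewrite cnorm0 => /(_ (ltW q0)).
  rewrite (rn_k0 r0 hK) expr1n expr0n subr0 -subr_gt0; apply: lt_le_trans.
  by rewrite mulr_gt0 ?(hardy_gt0 hK)// exprn_gt0.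
pose D := (A * B) ^+ 2 * (Gx - 1).
have D0 : 0 <= D by rewrite mulr_ge0 ?sqr_ge0// subr_ge0.
pose P := D * Gq / (Gq - 1).
have Gq0 : 0 <= Gq by apply: le_trans (ltW Gq1).
have Gqm : 0 <= Gq - 1 by rewrite subr_ge0 ltW.
have P0 : 0 <= P by apply: divr_ge0 => //; exact: mulr_ge0.
pose Q := D * Gq / (b 1%N * cnorm q ^+ 2).
have bq0 : 0 < b 1%N * cnorm q ^+ 2 by rewrite mulr_gt0 ?(hardy_gt0 hK)// exprn_gt0.
have Q0 : 0 <= Q by apply: divr_ge0; [exact: mulr_ge0 | exact: ltW].
pose c := Num.sqrt Q.
have c0 : 0 <= c := sqrtr_ge0 Q.
have kx0 : 0 <= A * rn (kH x) by rewrite mulr_ge0 ?rn_ge0.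
have Mx0 : 0 <= A * rn (kH x) * rn F by rewrite mulr_ge0 ?rn_ge0.
exists (A * rn (kH x) * rn F * P ^+ n + A * rn (kH x) * (c ^+ n * M)).
  by rewrite addr_ge0 ?mulr_ge0 ?exprn_ge0// rn_ge0.
move=> s s01; have /andP[s0 s1] := s01.
have Hs := dom_scale hH (rn_scale_le1 s01) Hx; have Ks := rp_phi p Hs.
have sn0 : 0 <= s ^+ n by rewrite exprn_ge0// ltW.
have ksx : rn (kH (s%:C *: x)) <= rn (kH x).
  rewrite -(@ler_pXn2r _ 2) ?nnegrE ?rn_ge0// (G_le hH Hx)// cnormZ.
  by rewrite ler_piMl ?cnorm_ge0// rn_scale_le1.
have [G2 [G21 G2E]] : exists G2, 1 <= G2 /\ rn (kK (phi (s%:C *: x))) ^+ 2 = G2.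
  by exists (rn (kK (phi (s%:C *: x))) ^+ 2); split=> //; exact: (G_ge1 r0 hK Ks).
have ang : G2 - 1 <= D * s ^+ 2 * G2.
  have := angle_distortion Hs; have := G_scale Hx s01; have := G_ge1 r0 hH Hs.
  rewrite G2E GxE; move: (rn _ ^+ 2) => G1 G11 hs ha.
  have h1 : G2 - 1 <= (G2 - 1) * G1 by rewrite ler_peMr// subr_ge0.
  apply: le_trans h1 (le_trans ha _).
  rewrite ler_wpM2r ?(le_trans _ G21)//.
  by rewrite /D -mulrA [_ * s ^+ 2]mulrC ler_wpM2l// sqr_ge0.
set y := phi _ in Ks G2E *.
have [qy|yq] := leP (cnorm q) (cnorm y).
  have Gq2 : Gq <= G2 by rewrite -GqE -G2E (G_le hK).
  have Ps : 1 <= P * s ^+ 2.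
    rewrite /P mulrAC ler_pdivlMr ?subr_gt0// mul1r mulrAC.
    have ds0 : 0 <= D * s ^+ 2 by rewrite mulr_ge0 ?sqr_ge0.
    move: (D * s ^+ 2) ang ds0 => z ang z0.
    have [z1|z1] := leP z 1.
      have := ler_wpM2r (_ : 0 <= 1 - z) Gq2; rewrite subr_ge0 => /(_ z1).
      by lra.
    have := ler_wpM2r Gq0 (ltW z1); lra.
  apply: (@le_trans _ _ (A * rn (kH x) * rn F)).
    apply: le_trans (dot_CS _ _) _; rewrite ler_wpM2r ?rn_ge0//.
    by apply: le_trans (rp_bT p _) _; rewrite ler_wpM2l.
  rewrite mulrDl -[leLHS]addr0; apply: lerD; last first.
    by do 3! (apply: mulr_ge0 => //); exact: exprn_ge0.
  rewrite -[leRHS]mulrA ler_peMr//; apply: (@le_trans _ _ ((P * s ^+ 2) ^+ n)).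
    by rewrite exprn_ege1.
  rewrite exprMn ler_wpM2l ?exprn_ge0// lerXn2r ?nnegrE ?sqr_ge0 ?(ltW s0)//.
  by rewrite expr2 ler_piMl// ltW.
have yc : cnorm y / cnorm q <= c * s.
  rewrite -(@ler_pXn2r _ 2) ?nnegrE ?mulr_ge0 ?invr_ge0 ?cnorm_ge0 ?(ltW s0)//.
  rewrite [leRHS]exprMn sqr_sqrtr// expr_div_n ler_pdivrMr ?exprn_gt0//.
  rewrite -(ler_pM2l (hardy_gt0 hK 1)).
  have -> : b 1%N * (Q * s ^+ 2 * cnorm q ^+ 2) = D * s ^+ 2 * Gq.
    by rewrite /Q; field; rewrite !gt_eqF// (hardy_gt0 hK).
  have G2q : G2 <= Gq by rewrite -GqE -G2E (G_le hK Kq (ltW yq)).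
  have := G_sub hK K0 Ks; rewrite cnorm0 (rn_k0 r0 hK) expr1n expr0n subr0 G2E.
  move=> /(_ (cnorm_ge0 _)) h1; apply: le_trans h1 (le_trans ang _).
  by rewrite ler_wpM2l// mulr_ge0 ?sqr_ge0.
rewrite mulrDl -[leLHS]add0r; apply: lerD.
  by do 2! (apply: mulr_ge0 => //); exact: exprn_ge0.
rewrite (rp_kT p Hs) dotZl rnM rn_conj dotC rn_conj -[leRHS]mulrA.
apply: ler_pM; rewrite ?rn_ge0//.
  exact: (le_trans (lam_le Hs) (ler_wpM2l A0 ksx)).
apply: le_trans (Fy _ (ltW yq)) _.
rewrite mulrAC -exprMn ler_wpM2r// lerXn2r ?nnegrE ?divr_ge0 ?cnorm_ge0//.
by rewrite mulr_ge0// ltW.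
Qed.

End SchwarzLemma.

Lemma coef_bound_radius (R : realType) (b : nat -> R) (rho W C : R) :
  (forall n, 0 < b n) -> 0 < rho -> conv_radius b = rho%:E ->
  (forall n, b n * W ^+ n <= C) -> W <= rho.
Proof.
move=> b0 rho0 rad bC; rewrite leNgt; apply/negP => lt.
pose W' := (rho + W) / 2.
have W0 : 0 < W by apply: lt_trans lt.
have W'0 : 0 < W' by rewrite divr_gt0// addr_gt0.
have W'W : W' < W by rewrite ltr_pdivrMr// ; lra.
have rW' : rho < W' by rewrite ltr_pdivlMr//; lra.
have q0 : 0 <= W' / W by apply: divr_ge0; exact: ltW.
have q1 : `|W' / W| < 1 by rewrite (ger0_norm q0) ltr_pdivrMr// mul1r.
have cW : cvgn (pseries b W').
  apply: (@series_le_cvg _ _ (geometric C (W' / W))).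
  - by move=> n; rewrite mulr_ge0 ?exprn_ge0 ?(ltW W'0)// ltW.
  - move=> n; apply: mulr_ge0; last exact: exprn_ge0.
    by apply: le_trans (bC 0%N); rewrite expr0 mulr1 ltW.
  - move=> n /=; rewrite [in leRHS]expr_div_n mulrA ler_pdivlMr ?exprn_gt0//.
    by rewrite mulrAC ler_wpM2r ?exprn_ge0 ?(ltW W'0).
  - exact: is_cvg_geometric_series.
have : (W'%:E <= conv_radius b)%E.
  by apply: ereal_sup_ubound; exists W' => //; split=> //; exact: ltW.
by rewrite rad lee_fin leNgt rW'.
Qed.

Section SchwarzEstimate.
Variables (R : realType) (d : nat) (r : R).
Hypothesis r0 : 0 < r.
Variables (a b : nat -> R) (H K : hilbert_function_space R 'rV[R[i]]_d).
Hypotheses (hH : hardy r a H) (hK : hardy r b K).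
Variables (A B : R) (phi psi : 'rV[R[i]]_d -> 'rV[R[i]]_d) (T : H -> K) (S : K -> H).
Variables (lam mu : 'rV[R[i]]_d -> R[i]).
Hypothesis p : @rk_pair R _ H K A B phi psi T S lam mu.
Hypothesis phi0 : phi 0 = 0.
Local Notation kH := (kernel_vec H).
Local Notation kK := (kernel_vec K).

(** The dilation weights remove the part of order less than n of h 0, at the
    cost of an error of order t, if h 0 vanishes to order n. *)
Lemma dilation_error (h : nat -> R -> R[i]) (C t : R) n :
  0 <= C -> 0 < t -> t < 1 ->
  (forall j s, h j.+1 s = h j s - (t^-1 ^+ j)%:C * h j (t * s)) ->
  (forall s, 0 < s <= 1 -> rn (h 0%N s) <= C * s ^+ n) ->
  rn (h n 1 - h 0%N 1) <= t * (2 ^+ n * C).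
Proof.
move=> C0 t0 t1 hS h0.
have claim j : (j <= n)%N -> forall s, 0 < s <= 1 ->
    rn (h j s) <= 2 ^+ j * C * s ^+ n /\
    rn (h j s - h 0%N s) <= t * (2 ^+ j * C) * s ^+ n.
  elim: j => [|j IH] jn s s01.
    rewrite expr0 !mul1r subrr rn0; split; first exact: h0.
    have /andP[s0 _] := s01.
    by rewrite !mulr_ge0 ?exprn_ge0// ltW.
  have /andP[s0 s1] := s01.
  have ts01 : 0 < t * s <= 1 by rewrite mulr_gt0//= mulr_ile1 ?(ltW t0) ?(ltW t1) ?(ltW s0).
  have [h1 h2] := IH (ltnW jn) s s01; have [h3 _] := IH (ltnW jn) (t * s) ts01.
  have sn0 : 0 <= s ^+ n by rewrite exprn_ge0 ?ltW.
  have c0 : 0 <= 2 ^+ j * C by rewrite mulr_ge0 ?exprn_ge0.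
  have h4 : rn ((t^-1 ^+ j)%:C * h j (t * s)) <= t * (2 ^+ j * C * s ^+ n).
    have ti : 0 <= t^-1 ^+ j by rewrite exprn_ge0 ?invr_ge0 ?ltW.
    rewrite rnM rn_real (ger0_norm ti).
    apply: le_trans (ler_wpM2l ti h3) _.
    rewrite exprMn.
    have -> : t^-1 ^+ j * (2 ^+ j * C * (t ^+ n * s ^+ n)) =
        (t^-1 ^+ j * t ^+ n) * (2 ^+ j * C * s ^+ n) by ring.
    apply: ler_wpM2r; first exact: mulr_ge0.
    have -> : t^-1 ^+ j * t ^+ n = t ^+ (n - j).
      by rewrite -{1}(subnKC (ltnW jn)) exprD mulrA -exprMn mulVf ?gt_eqF// expr1n mul1r.
    by rewrite -[leRHS]expr1 ler_wiXn2l ?subn_gt0 ?(ltW t0) ?(ltW t1).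
  have cs0 : 0 <= 2 ^+ j * C * s ^+ n by exact: mulr_ge0.
  rewrite hS !exprS; split.
    apply: le_trans (rnB _ _) _.
    have h5 : t * (2 ^+ j * C * s ^+ n) <= 2 ^+ j * C * s ^+ n.
      by rewrite ler_piMl// ltW.
    by move: h1 h4 h5; move: (rn _) (rn _) => X Y; lra.
  rewrite addrAC; apply: le_trans (rnB _ _) _.
  by move: h2 h4; move: (rn _) (rn _) => X Y; lra.
have [_] := claim n (leqnn n) 1 ltac:(by rewrite ltr01 lexx).
by rewrite expr1n mulr1.
Qed.

(** The maximum principle for the functions F o phi on the line through x, with
    F a peak function of order n: their part of order less than n vanishes. *)
Lemma order_n_estimate x (t : R) n : hfs_dom H x -> phi x != 0 -> 0 < t -> t < 1 ->
  rn (lam x) ^+ 2 * (b n * ((1 - t) * cnorm (phi x) ^+ 2) ^+ n) <=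
  A ^+ 2 * tail a H n x.
Proof.
move=> Hx qn0 t0 t1; have Kq := rp_phi p Hx.
have q0 : 0 < cnorm (phi x).
  by rewrite lt_def cnorm_ge0 andbT; apply: contra_neq qn0; exact: cnorm_eq0.
have [F [M [M0 FM FnM bM Fy]]] := peak_exists n t0 t1 hK Kq qn0.
have [C C0 hC] := order_bound r0 hH hK p phi0 Hx Kq q0 (ltW M0) Fy.
have A0 := rp_A0 p.
have tail_ge s : 0 < s -> s < 1 -> rn (comb H (dil s n) x) ^+ 2 <= tail a H n x.
  move=> s0 s1; apply: (comb_le_tail hH _ Hx).
  - by apply: in_disc_dil; exact: ltW.
  - by move=> m mn; rewrite coef_dil wgt_lt ?gt_eqF.
  - move=> m; rewrite coef_dil rn_real.
    by have /andP[w0 w1] := wgt_itv n m s0 s1; rewrite ger0_norm.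
have tl0 : 0 <= tail a H n x by apply: le_trans (tail_ge _ t0 t1); exact: sqr_ge0.
pose tau := Num.sqrt (tail a H n x).
have tau0 : 0 <= tau := sqrtr_ge0 _.
have TZ := scaleP (rp_linT p).
have TB u v : T (u - v) = T u - T v.
  have := rp_linT p (-1) v u; rewrite !scaleN1r addrC => ->.
  by rewrite addrC.
have small s : 0 < s -> s < 1 ->
    rn (hfs_dot K (T (kH x)) F) <= A * tau * rn F + s * (2 ^+ n * C).
  move=> s0 s1.
  pose h j u := hfs_dot K (T (comb H (dil s j) (u%:C *: x))) F.
  have hS j u : h j.+1 u = h j u - (s^-1 ^+ j)%:C * h j (s * u).
    by rewrite /h comb_dilS TB TZ dotBl dotZl scalerA -rmorphM.
  have comb0 z : comb H (dil s 0) z = kH z.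
    by rewrite /comb big_seq1 /= !scale1r.
  have h0 u : 0 < u <= 1 -> rn (h 0%N u) <= C * u ^+ n.
    by move=> u01; rewrite /h comb0; exact: hC.
  have err := dilation_error C0 s0 s1 hS h0.
  have hn : rn (h n 1) <= A * tau * rn F.
    rewrite /h scale1r; apply: le_trans (dot_CS _ _) _.
    apply: ler_wpM2r; first exact: rn_ge0.
    apply: le_trans (rp_bT p _) _; apply: ler_wpM2l => //.
    rewrite -(@ler_pXn2r _ 2) ?nnegrE ?rn_ge0// sqr_sqrtr//.
    exact: tail_ge.
  have -> : hfs_dot K (T (kH x)) F = h 0%N 1 by rewrite /h comb0 scale1r.
  rewrite -[h 0%N 1](subKr (h n 1)); apply: le_trans (rnB _ _) _.
  exact: lerD.
have key : rn (hfs_dot K (T (kH x)) F) <= A * tau * rn F.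
  apply/ler_addgt0Pr => e e0.
  have D0 : 0 < 1 + 2 ^+ n * C by rewrite ltr_pwDl// mulr_ge0 ?exprn_ge0.
  pose s := Num.min (2^-1) (e / (1 + 2 ^+ n * C)).
  have s0 : 0 < s by rewrite lt_min invr_gt0 ltr0n divr_gt0.
  have s1 : s < 1 by rewrite gt_min invf_lt1// ltr1n.
  have se : s * (1 + 2 ^+ n * C) <= e by rewrite -ler_pdivlMr// ge_min lexx orbT.
  apply: le_trans (small s s0 s1) _; rewrite lerD2l; apply: le_trans se.
  by rewrite ler_pM2l// lerDr.
have low : rn (lam x) * M <= A * tau * rn F.
  apply: le_trans key; rewrite (rp_kT p Hx) dotZl rnM rn_conj dotC rn_conj.
  by apply: ler_wpM2l => //; exact: rn_ge0.
have low2 : (rn (lam x) * M) ^+ 2 <= (A * tau * rn F) ^+ 2.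
  by apply: lerXn2r => //; rewrite nnegrE !mulr_ge0 ?rn_ge0 ?(ltW M0).
rewrite !exprMn sqr_sqrtr// in low2.
have low3 : rn (lam x) ^+ 2 * M <= A ^+ 2 * tail a H n x.
  rewrite -(ler_pM2r M0) -mulrA -expr2; apply: le_trans low2 _.
  by apply: ler_wpM2l => //; rewrite mulr_ge0 ?sqr_ge0.
by apply: le_trans low3; apply: ler_wpM2l => //; exact: sqr_ge0.
Qed.

(** Against the growth of the coefficients of K, the estimate of order n only
    leaves room for |phi x| <= |x|. *)
Lemma schwarz x : cnorm x < r -> cnorm (phi x) <= cnorm x.
Proof.
move=> xr; have Hx := dom_ball hH xr; rewrite leNgt; apply/negP => xq.
have x0 : 0 < cnorm x.
  rewrite lt_def cnorm_ge0 andbT; apply/negP => /eqP /cnorm_eq0 xz.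
  by move: xq; rewrite xz phi0 ltxx.
have q0 : 0 < cnorm (phi x) by apply: lt_trans xq.
have qn0 : phi x != 0 by apply/eqP => e; move: q0; rewrite e cnorm0 ltxx.
pose sg := cnorm (phi x) / cnorm x.
have sg1 : 1 < sg by rewrite ltr_pdivlMr// mul1r.
have sg0 : 0 < sg by apply: lt_trans sg1.
have rs : r / sg < r by rewrite ltr_pdivrMr// ltr_pMr.
pose rho := (Num.max (cnorm x) (r / sg) + r) / 2.
have mr : Num.max (cnorm x) (r / sg) < r by rewrite gt_max xr rs.
have rho1 : Num.max (cnorm x) (r / sg) < rho by rewrite ltr_pdivlMr//; lra.
have rhor : rho < r by rewrite ltr_pdivrMr//; lra.
have /andP[xrho srho] : (cnorm x < rho) && (r / sg < rho) by rewrite -gt_max.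
have rho0 : 0 < rho by apply: lt_trans xrho.
have W0 : r < rho * sg by rewrite -ltr_pdivrMr.
have W2 : r ^+ 2 < (rho * sg) ^+ 2.
  by rewrite ltr_pXn2r ?nnegrE// ltW// mulr_gt0.
set W := (rho * sg) ^+ 2 in W2.
have r20 : 0 < r ^+ 2 by rewrite exprn_gt0.
have Wp : 0 < W by apply: lt_trans W2.
pose t := (1 - r ^+ 2 / W) / 2.
have rW : 0 < r ^+ 2 / W < 1 by rewrite divr_gt0//= ltr_pdivrMr// mul1r.
have /andP[rW0 rW1] := rW.
have t0 : 0 < t by rewrite divr_gt0// subr_gt0.
have t1 : t < 1 by rewrite ltr_pdivrMr//; lra.
have tW : r ^+ 2 < (1 - t) * W.
  have -> : (1 - t) * W = (W + r ^+ 2) / 2 by rewrite /t; field; rewrite gt_eqF.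
  by rewrite ltr_pdivlMr//; lra.
pose y := (rho / cnorm x)%:C *: x.
have ny : cnorm y = rho.
  by rewrite cnormZ rn_real ger0_norm ?divfK ?gt_eqF// divr_ge0 ?ltW.
have Hy : hfs_dom H y by apply: (dom_ball hH); rewrite ny.
have l0 : 0 < rn (lam x) ^+ 2.
  by rewrite exprn_gt0// lt_def rn_ge0 rn_eq0 (rp_lam p Hx).
have : (1 - t) * W <= r ^+ 2.
  apply: (@coef_bound_radius _ b _ _ (A ^+ 2 * rn (kH y) ^+ 2 / rn (lam x) ^+ 2)) => //.
  - exact: (hardy_gt0 hK).
  - exact: (hardy_radius hK).
  move=> n; rewrite ler_pdivlMr// [leLHS]mulrC.
  have est := order_n_estimate n Hx qn0 t0 t1.
  have tl : tail a H n x <= ((cnorm x / rho) ^+ 2) ^+ n * rn (kH y) ^+ 2.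
    by rewrite -ny; apply: (tail_le hH n Hy); rewrite ny// ltW.
  have A2 : 0 <= A ^+ 2 := sqr_ge0 _.
  have est2 := le_trans est (ler_wpM2l A2 tl).
  have xr2 : 0 < ((cnorm x / rho) ^+ 2) ^+ n by rewrite !exprn_gt0// divr_gt0.
  have e : ((1 - t) * W) ^+ n * ((cnorm x / rho) ^+ 2) ^+ n =
      ((1 - t) * cnorm (phi x) ^+ 2) ^+ n.
    by rewrite -exprMn; congr (_ ^+ n); rewrite /W /sg; field; rewrite !gt_eqF.
  rewrite -(ler_pM2r xr2) -mulrA -[b n * _ * _]mulrA e.
  by apply: le_trans est2 _; rewrite le_eqVlt; apply/orP; left; apply/eqP; ring.
by rewrite leNgt tW.
Qed.

End SchwarzEstimate.

(** * Equal kernels at distance zero *)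

Section Definiteness.
Variables (R : realType) (d : nat) (r : R).
Hypothesis r0 : 0 < r.
Implicit Types (a b : nat -> R) (H K : hilbert_function_space R 'rV[R[i]]_d).

Lemma G_norm a H x y : hardy r a H -> hfs_dom H x -> cnorm x = cnorm y ->
  rn (kernel_vec H x) ^+ 2 = rn (kernel_vec H y) ^+ 2.
Proof.
move=> hH Hx e; have Hy : hfs_dom H y by apply: (dom_le hH Hx); rewrite e.
by apply/eqP; rewrite eq_le (G_le hH Hy) ?(G_le hH Hx)// e.
Qed.

(** After moving phi 0 to the origin, at the price of cubing the condition number,
    the Schwarz lemma for phi and its inverse gives |phi x| = |x|. So the
    distortion of the angles compares the kernels at the same point. *)
Lemma diagonal_comparison a b H K (A B : R) x : hardy r a H -> hardy r b K ->
  related H K A B -> cnorm x < r ->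
  (rn (kernel_vec K x) ^+ 2 - 1) * rn (kernel_vec H x) ^+ 2 <=
  (A * B) ^+ 6 * ((rn (kernel_vec H x) ^+ 2 - 1) * rn (kernel_vec K x) ^+ 2).
Proof.
move=> hH hK rel xr.
have [A' [B' [phi [psi [T [S [lam [mu [p phi0 AB]]]]]]]]] := fix_origin r0 hH hK rel.
have Hx := dom_ball hH xr; have Kx := rp_phi p Hx.
have psi0 : psi 0 = 0 by rewrite -{1}phi0 (rp_phiK p (dom0 r0 hH)).
have le1 := schwarz r0 hH hK p phi0 xr.
have le2 := schwarz r0 hK hH (rk_pair_sym p) psi0 (le_lt_trans le1 xr).
rewrite (rp_phiK p Hx) in le2.
have e : cnorm (phi x) = cnorm x by apply/eqP; rewrite eq_le le1 le2.
have := angle_distortion r0 hH hK p phi0 Hx.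
by rewrite (G_norm hK Kx e) AB -exprM -mulrA.
Qed.

(** In the limit A B = 1, the comparison is (G_K - 1) G_H <= (G_H - 1) G_K for the
    kernels on the diagonal, that is G_K <= G_H. *)
Lemma diagonal_le a b H K x : hardy r a H -> hardy r b K ->
  (forall e, 0 < e -> exists A B, related H K A B /\ A * B < 1 + e) ->
  cnorm x < r -> rn (kernel_vec K x) ^+ 2 <= rn (kernel_vec H x) ^+ 2.
Proof.
move=> hH hK rel xr.
have cmp e (A B : R) : related H K A B -> A * B < 1 + e -> 0 < e ->
   (rn (kernel_vec K x) ^+ 2 - 1) * rn (kernel_vec H x) ^+ 2 <=
   (1 + e) ^+ 6 * ((rn (kernel_vec H x) ^+ 2 - 1) * rn (kernel_vec K x) ^+ 2).
  move=> rAB lt e0; apply: le_trans (diagonal_comparison hH hK rAB xr) _.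
  have G1 := G_ge1 r0 hH (dom_ball hH xr).
  apply: ler_wpM2r; first by rewrite mulr_ge0 ?sqr_ge0// subr_ge0.
  have AB0 : 0 <= A * B.
    case: rAB => [phi [psi [T [S [lam [mu p]]]]]].
    by rewrite mulr_ge0 ?(rp_A0 p) ?(rp_B0 p).
  by apply: lerXn2r; rewrite ?nnegrE ?(ltW lt)//; exact: le_trans (ltW lt).
have G1 := G_ge1 r0 hH (dom_ball hH xr); have G2 := G_ge1 r0 hK (dom_ball hK xr).
move: (rn (kernel_vec K x) ^+ 2) (rn (kernel_vec H x) ^+ 2) cmp G1 G2.
move=> GK GH cmp GH1 GK1.
suff : (GK - 1) * GH <= (GH - 1) * GK by lra.
have c0 : 0 <= (GH - 1) * GK by rewrite mulr_ge0 ?subr_ge0// (le_trans ler01).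
move: ((GH - 1) * GK) c0 cmp => c c0 cmp.
apply/ler_addgt0Pr => e e0.
pose e' := Num.min 1 (e / (63 * (1 + c))).
have D0 : 0 < 63 * (1 + c) by rewrite mulr_gt0// ltr_pwDl.
have e'0 : 0 < e' by rewrite lt_min ltr01 divr_gt0.
have e'1 : e' <= 1 by rewrite ge_min lexx.
have e'e : e' * (63 * (1 + c)) <= e by rewrite -ler_pdivlMr// ge_min lexx orbT.
have [A [B [rAB lt]]] := rel _ e'0.
apply: le_trans (cmp _ _ _ rAB lt e'0) _.
(* by convexity, (1 + t)^6 <= 1 + 63 t for t in the unit interval *)
have p3 : (1 + e') ^+ 3 <= 1 + 7 * e'.
  have h1 : e' ^+ 2 <= e' by rewrite expr2 ler_piMl// ltW.
  have h2 : e' ^+ 3 <= e' ^+ 2 by rewrite exprS ler_piMl// sqr_ge0.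
  have -> : (1 + e') ^+ 3 = 1 + 3 * e' + 3 * e' ^+ 2 + e' ^+ 3 by ring.
  by lra.
have p6 : (1 + e') ^+ 6 <= 1 + 63 * e'.
  have p30 : 0 <= (1 + e') ^+ 3 by rewrite exprn_ge0// addr_ge0// ltW.
  rewrite (exprM _ 3 2); apply: (@le_trans _ _ ((1 + 7 * e') ^+ 2)).
    by apply: lerXn2r; rewrite // nnegrE; exact: le_trans p3.
  have h1 : e' ^+ 2 <= e' by rewrite expr2 ler_piMl// ltW.
  have -> : (1 + 7 * e') ^+ 2 = 1 + 14 * e' + 49 * e' ^+ 2 by ring.
  by lra.
apply: le_trans (ler_wpM2r c0 p6) _.
by nra.
Qed.

(** Equal sums on an interval force equal coefficients: divide the tails of
    order n by the n-th power of the variable and let it tend to 0. *)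
Lemma coefficients_le a b H K : (0 < d)%N -> hardy r a H -> hardy r b K ->
  (forall x, cnorm x < r ->
    rn (kernel_vec K x) ^+ 2 = rn (kernel_vec H x) ^+ 2) ->
  forall n, (forall m, (m < n)%N -> a m = b m) -> a n <= b n.
Proof.
move=> d0 hH hK eG n ab.
have r2 : 0 < r / 2 by rewrite divr_gt0.
have r2r : r / 2 < r by rewrite ltr_pdivrMr//; lra.
have [y ny] := point_of_norm d0 (ltW r2).
have Ky : hfs_dom K y by apply: (dom_ball hK); rewrite ny.
pose C := rn (kernel_vec K y) ^+ 2 / ((r / 2) ^+ 2) ^+ n.+1.
have C0 : 0 <= C by apply: divr_ge0; [exact: sqr_ge0 | do 2! apply: exprn_ge0; exact: ltW].
have tS (c : nat -> R) L m x : tail c L m x = c m * (cnorm x ^+ 2) ^+ m + tail c L m.+1 x.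
  by rewrite /tail big_nat_recr//=; ring.
have key s : 0 < s -> s <= r / 2 -> a n <= b n + s ^+ 2 * C.
  move=> s0 sr; have [x nx] := point_of_norm d0 (ltW s0).
  have xr : cnorm x < r by rewrite nx; exact: le_lt_trans r2r.
  have Hx := dom_ball hH xr.
  have et : tail a H n x = tail b K n x.
    by rewrite /tail eG//; congr (_ - _); rewrite !big_nat; apply: eq_bigr => i /ab ->.
  have t0 : 0 <= tail a H n.+1 x.
    apply: le_trans (series_ge_term 0 (@tail_series _ _ _ _ _ hH n.+1 _ Hx) _) => //.
    by move=> m; case: ifP => // _; exact: (G_term_ge0 hH).
  have := tail_le hK n.+1 Ky (_ : cnorm x <= cnorm y); rewrite nx ny => /(_ sr r2) tl.
  have sn : 0 < (s ^+ 2) ^+ n by rewrite !exprn_gt0.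
  rewrite -(ler_pM2r sn).
  apply: (@le_trans _ _ (tail a H n x)); first by rewrite tS nx lerDl.
  rewrite et tS nx mulrDl lerD2l; apply: le_trans tl _.
  rewrite expr_div_n expr_div_n /C le_eqVlt; apply/orP; left; apply/eqP.
  by rewrite exprS; field; rewrite ?expf_neq0// gt_eqF.
apply/ler_addgt0Pr => e e0.
pose s := Num.min (r / 2) (Num.min 1 (e / (1 + C))).
have C1 : 0 < 1 + C by rewrite ltr_pwDl.
have s0 : 0 < s by rewrite !lt_min r2 ltr01 divr_gt0.
have sr : s <= r / 2 by rewrite ge_min lexx.
have s1 : s <= 1 by rewrite !ge_min lexx orbT.
have se : s * (1 + C) <= e by rewrite -ler_pdivlMr// !ge_min lexx !orbT.
apply: le_trans (key s s0 sr) _; rewrite lerD2l; apply: le_trans se.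
have h1 : s ^+ 2 <= s by rewrite expr2 ler_piMl// ltW.
apply: le_trans (ler_wpM2r C0 h1) _.
by rewrite ler_pM2l// lerDr.
Qed.

Lemma hardy_same a H K : hardy r a H -> hardy r a K -> same_hfs H K.
Proof.
move=> hH hK; have eD : hfs_dom H = hfs_dom K by rewrite (hardy_dom hH) (hardy_dom hK).
apply: kernel_eq_same => // x y Hx Hy.
have Kx : hfs_dom K x by rewrite -eD.
have Ky : hfs_dom K y by rewrite -eD.
exact: (cvg_unique (@norm_hausdorff _ _) (hardy_ker hK Ky Kx) (hardy_ker hH Hy Hx)).
Qed.

Lemma hardy_definite a b H K : (0 < d)%N -> hardy r a H -> hardy r b K ->
  (forall e, 0 < e -> exists A B, related H K A B /\ A * B < 1 + e) ->
  same_hfs H K.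
Proof.
move=> d0 hH hK rel.
have rel' e : 0 < e -> exists A B, related K H A B /\ A * B < 1 + e.
  move=> /rel[A [B [rAB lt]]]; exists B, A; rewrite mulrC; split=> //.
  exact: related_sym.
have eG x : cnorm x < r -> rn (kernel_vec K x) ^+ 2 = rn (kernel_vec H x) ^+ 2.
  by move=> xr; apply/eqP; rewrite eq_le (diagonal_le hH hK)// (diagonal_le hK hH).
have ab n : a n = b n.
  elim/ltn_ind: n => n IH; apply/eqP; rewrite eq_le; apply/andP; split.
    by apply: (coefficients_le d0 hH hK eG).
  apply: (coefficients_le d0 hK hH) => [x xr|m mn]; first by rewrite eG.
  by rewrite IH.
have {}ab : a = b by apply/funext.
by rewrite ab in hH; exact: hardy_same hH hK.
Qed.

End Definiteness.

Lemma iso_class_related (R : realType) (d : nat) (r : R)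
    (H K : hilbert_function_space R 'rV[R[i]]_d) :
  iso_class r H K -> exists A B, related H K A B.
Proof.
move=> [_ [T isoT]]; have [[S TK SK] _ _] := isoT.
have [A [B [phi [psi [lam [mu [_ _ p]]]]]]] := rk_iso_rk_pair isoT TK SK.
by exists A, B, phi, psi, T, S, lam, mu.
Qed.

Theorem corollary8p6 (R : realType) (d : nat) (hd : (0 < d)%N) (r : R)
    (hr : 0 < r) (H : hilbert_function_space R 'rV[R[i]]_d)
    (hH : weighted_hardy r H) :
  metric_on (iso_class r H) (@same_hfs R 'rV[R[i]]_d)
    (@rho_RK R 'rV[R[i]]_d).
Proof.
apply: rho_metric => [K [/weighted_hardyP[a hK] _]|K L CK CL|K L CK CL rel].
- exists (kernel_vec K 0); apply/eqP => k0.
  have := rn_k0 hr hK; rewrite k0 rn0 => /eqP.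
  by rewrite eq_sym oner_eq0.
- have [A [B relK]] := iso_class_related CK.
  have [A' [B' relL]] := iso_class_related CL.
  by do 2 eexists; exact: related_comp (related_sym relK) relL.
- have [/weighted_hardyP[a hK] _] := CK.
  have [/weighted_hardyP[b hL] _] := CL.
  exact: (hardy_definite hr hd hK hL rel).
Qed.
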